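(* Let $m\ge 2$ and $1\le n\le m$ be integers. Let $\rho$ be a density operator on $\mathcal{H}_A\otimes\mathcal{H}_{B_1}\otimes\cdots\otimes\mathcal{H}_{B_n}$ (finite-dimensional, $\dim\mathcal{H}_A=d$). Let $M_1,\dots,M_m$ be observables on $\mathcal{H}_A$ with orthonormal eigenbases $\{|\psi^i_k\rangle\}_{k=1}^d$. Let $\mathbf{S}_1,\dots,\mathbf{S}_n$ be nonempty, pairwise disjoint subsets of $\{M_1,\dots,M_m\}$ whose union is $\{M_1,\dots,M_m\}$, and $m_t=|\mathbf{S}_t|$. Then $$\sum_{t=1}^n\sum_{M_i\in\mathbf{S}_t}S(M_i|B_t)\geqslant-\frac{1}{m-1}\log_2\Big(\prod_{1\le i<j\le m}c_{ij}\Big)+\frac{1}{m-1}\sum_{t=1}^n\frac{m_t(m_t-1)}{2}S(A|B_t)+\max\{0,\delta'_{mn}\},$$ where $$\delta'_{mn}=\frac{1}{m-1}\log_2\frac{\prod_{1\le i<j\le m}c_{ij}}{b^{m-1}}+(m-1)S(A)-\sum_{t=1}^n\frac{m_t(m_t-1)}{2(m-1)}S(A)+\sum_{t=1}^n\frac{m_t(m_t-1)}{2(m-1)}\mathcal{I}(A:B_t)-\sum_{t=1}^n\sum_{M_i\in\mathbf{S}_t}\mathcal{I}(M_i:B_t)$$ and $$b=\max_{k_m}\Big\{\sum_{k_2}\cdots\sum_{k_{m-1}}\max_{k_1}|\langle\psi^1_{k_1}|\psi^2_{k_2}\rangle|^2\prod_{i=2}^{m-1}|\langle\psi^i_{k_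i}|\psi^{i+1}_{k_{i+1}}\rangle|^2\Big\}.$$
   Context: All logarithms are base 2. $S(\sigma)=-\mathrm{Tr}\,\sigma\log_2\sigma$; $\rho^X$ is the reduced state of $\rho$ on subsystem(s) $X$, and $S(A)=S(\rho^A)$. $c_{ij}=\max_{k,l}|\langle\psi^i_k|\psi^j_l\rangle|^2$. $S(A|B_t)=S(\rho^{AB_t})-S(\rho^{B_t})$. $\mathcal{I}(A:B_t)=S(\rho^A)+S(\rho^{B_t})-S(\rho^{AB_t})$. Post-measurement state: $\rho^{M_iB_t}=\sum_k(|\psi^i_k\rangle\langle\psi^i_k|\otimes\mathbb{I})\rho^{AB_t}(|\psi^i_k\rangle\langle\psi^i_k|\otimes\mathbb{I})$, with reduced state $\rho^{M_i}$ on $A$. $S(M_i|B_t)=S(\rho^{M_iB_t})-S(\rho^{B_t})$, and $\mathcal{I}(M_i:B_t)=S(\rho^{M_i})+S(\rho^{B_t})-S(\rho^{M_iB_t})$. Each index $k_i$ ranges over $\{1,\dots,d\}$. *)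

(* Defs.v *)
(* MathComp + MathComp-Analysis (ln) + real_closed (complex numbers R[i])
   + algebra/spectral.v (spectral decomposition of normal matrices). *)
From HB Require Import structures.
From mathcomp Require Import all_boot all_order all_algebra.
From mathcomp Require Import sesquilinear spectral.
From mathcomp Require Import complex.
From mathcomp Require Import reals exp.

Set Implicit Arguments.
Unset Strict Implicit.
Unset Printing Implicit Defensive.

Import Order.TTheory GRing.Theory Num.Theory.
Local Open Scope ring_scope.

Section QInfo.
Variable R : realType.
Local Notation C := R[i].

(** logarithm base 2 *)
Definition log2 (x : R) : R := ln x / ln 2.

(** Operators on the finite-dimensional Hilbert space C^T, T a finite index
    type (the computational basis); X x y is the matrix entry <x|X|y>. *)
Definition op (T : finType) := T -> T -> C.

Definition trace (T : finType) (X : op T) : C := \sum_(x : T) X x x.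

Definition herm_op (T : finType) (X : op T) : Prop :=
  forall x y, X x y = (X y x)^*.

Definition psd (T : finType) (X : op T) : Prop :=
  herm_op X /\
  forall v : T -> C, 0 <= \sum_(x : T) \sum_(y : T) (v x)^* * X x y * v y.

(** density operator: positive semidefinite with unit trace *)
Definition density (T : finType) (X : op T) : Prop := psd X /\ trace X = 1.

(** the operator as a square matrix, after enumerating T *)
Definition mx_of (T : finType) (X : op T) : 'M[C]_#|T| :=
  \matrix_(i, j) X (enum_val i) (enum_val j).

(** functional calculus f(A) := U^-1 diag(f(lambda)) U for a normal
    (in particular Hermitian) matrix A = U^-1 diag(lambda) U (spectral theorem) *)
Definition mxfun n (f : R -> R) (A : 'M[C]_n) : 'M[C]_n :=
  invmx (spectralmx A)
  *m diag_mx (map_mx (fun z : C => Complex (f (complex.Re z)) 0) (spectral_diag A))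
  *m spectralmx A.

(** von Neumann entropy S(s) = - Tr s log2 s *)
Definition entropy (T : finType) (s : op T) : R :=
  - complex.Re (\tr (mx_of s *m mxfun log2 (mx_of s))).

(** partial traces on a bipartite space U * V *)
Definition ptr2 (U V : finType) (X : op (U * V)%type) : op U :=
  fun a a' => \sum_(v : V) X (a, v) (a', v).
Definition ptr1 (U V : finType) (X : op (U * V)%type) : op V :=
  fun b b' => \sum_(u : U) X (u, b) (u, b').

(** the global system H_A (x) H_B1 (x) ... (x) H_Bn, dim H_A = d *)
Definition sys (d n : nat) (B : 'I_n -> finType) : finType :=
  ('I_d * {dffun forall t : 'I_n, B t})%type.

(** reduced state rho^{A B_t}: trace out all B_s with s <> t *)
Definition red_AB (d n : nat) (B : 'I_n -> finType) (rho : op (sys d B))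
  (t : 'I_n) : op ('I_d * B t)%type :=
  fun u v => \sum_(x : sys d B) \sum_(y : sys d B |
      [&& x.1 == u.1, x.2 t == u.2, y.1 == v.1, y.2 t == v.2 &
          [forall s : 'I_n, (s != t) ==> (x.2 s == y.2 s)]]) rho x y.

(** reduced state rho^A: trace out all B's *)
Definition red_A (d n : nat) (B : 'I_n -> finType) (rho : op (sys d B)) : op 'I_d :=
  fun a a' => \sum_(x : sys d B) \sum_(y : sys d B |
      [&& x.1 == a, y.1 == a' & x.2 == y.2]) rho x y.

(** inner product <u|v> on C^d and squared modulus *)
Definition ip (d : nat) (u v : 'I_d -> C) : C := \sum_(a : 'I_d) (u a)^* * v a.
Definition abs2 (z : C) : R := complex.Re (`|z| ^+ 2).

(** post-measurement state rho^{M B} = sum_k (P_k (x) I) X (P_k (x) I),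
    P_k = |psi_k><psi_k|, where psi k a is the a-th coordinate of psi_k *)
Definition meas (d : nat) (U : finType) (psi : 'I_d -> 'I_d -> C)
  (X : op ('I_d * U)%type) : op ('I_d * U)%type :=
  fun u v => \sum_(k : 'I_d) \sum_(c : 'I_d) \sum_(c' : 'I_d)
     (psi k u.1 * (psi k c)^*) * X (c, u.2) (c', v.2) * (psi k c' * (psi k v.1)^*).

(** c_ij = max_{k,l} |<psi^i_k|psi^j_l>|^2 *)
Definition cij (m d : nat) (psi : 'I_m -> 'I_d -> 'I_d -> C) (i j : 'I_m) : R :=
  \big[Num.max/0]_(k : 'I_d) \big[Num.max/0]_(l : 'I_d) abs2 (ip (psi i k) (psi j l)).

(** predecessor index j-1 in 'I_m *)
Definition prv (m : nat) (j : 'I_m) : 'I_m :=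
  Ordinal (leq_ltn_trans (leq_pred j) (ltn_ord j)).

(** b = max_{k_m} sum_{k_2..k_{m-1}} max_{k_1} |<psi^1_{k1}|psi^2_{k2}>|^2
        prod_{i=2}^{m-1} |<psi^i_{ki}|psi^{i+1}_{k(i+1)}>|^2.
    Indices are 0-based here: paper's M_i is index i-1.  The tuple
    (k_1,...,k_m) is kappa; kappa at index m-1 is k_m, kappa at index 0 is
    a dummy coordinate pinned to k_m (k_1 is maximised separately). *)
Definition bconst (m d : nat) (hm : (1 < m)%N) (psi : 'I_m -> 'I_d -> 'I_d -> C) : R :=
  let i1 : 'I_m := Ordinal hm in
  let i0 : 'I_m := prv i1 in
  \big[Num.max/0]_(km : 'I_d)
    \sum_(kappa : {ffun 'I_m -> 'I_d} |
            [forall i : 'I_m, ((i == 0%N :> nat) || (i == m.-1 :> nat)) ==> (kappa i == km)])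
      ((\big[Num.max/0]_(k1 : 'I_d) abs2 (ip (psi i0 k1) (psi i1 (kappa i1))))
       * \prod_(j : 'I_m | (2 <= j)%N)
            abs2 (ip (psi (prv j) (kappa (prv j))) (psi j (kappa j)))).

End QInfo.
Arguments red_AB {R d n B} rho t _ _.

(* Main.v *)
Require Import Defs.
From HB Require Import structures.
From mathcomp Require Import all_boot all_order all_algebra.
From mathcomp Require Import sesquilinear spectral.
From mathcomp Require Import complex.
From mathcomp Require Import reals exp.
From mathcomp Require Import ring lra.
Import Order.TTheory GRing.Theory Num.Theory.

(** The first bound sums, over all pairs i < j, one of two relations: if M_i and M_j
    share the memory B, then S(M_i|B) + S(M_j|B) >= -log c_ij + S(A|B); if they have
    different memories, the same holds without the last term.  The second bound
    reduces to \sum_i H(M_i) >= -log b + (m - 1) S(A).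

    Everything rests on the monotonicity of the relative entropy
    D(rho||sigma) = Tr rho (ln rho - ln sigma) under a channel Phi, in the form
    D(Phi rho||sigma') <= D(rho||sigma) whenever Phi sigma <= sigma'.  Eigenvalue by
    eigenvalue, r ln (r/s) is the integral over u in (0, 1) of
    (r^2 / (u s + (1 - u) r) - r) / u, and the first summand corresponds to
      sup_Y  2 Re Tr Y^* rho - u Tr Y^* sigma Y - (1 - u) Tr Y rho Y^* ,
    which the Kadison-Schwarz inequality for the adjoint of Phi makes monotone.
    Right Riemann sums replace the integral.

    - Same memory: Phi measures M_j, sigma is the state after measuring M_i, and
      sigma' = c_ij (1 (x) rho_B).
    - Different memories: purify.  Strong subadditivity (Phi a partial trace) and the
      equality of the entropies of the two marginals of a pure state reduce this to
      the previous case.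
    - \sum_i H(M_i): measure M_2, M_3, ... in turn, where sigma is diagonal in the
      basis of M_j with the partial sums that build up b as eigenvalues. *)

Set Implicit Arguments.
Unset Strict Implicit.
Unset Printing Implicit Defensive.
Local Open Scope ring_scope.
Local Open Scope sesquilinear_scope.
Local Open Scope complex_scope.

(** * Real parts and squared moduli of complex numbers *)

Section ComplexFacts.
Variable R : realType.
Local Notation C := R[i].
Local Notation Re := complex.Re.

Lemma conjCE (z : C) : (z^*)%R = conjc z. Proof. by []. Qed.

Lemma ReD (x y : C) : Re (x + y) = Re x + Re y.
Proof. by case: x; case: y. Qed.

Lemma ReN (x : C) : Re (- x) = - Re x.
Proof. by case: x. Qed.

Lemma ReB (x y : C) : Re (x - y) = Re x - Re y.
Proof. by rewrite ReD ReN. Qed.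

Lemma ReZ (a : R) (z : C) : Re (a%:C * z) = a * Re z.
Proof. by case: z => x y /=; rewrite mul0r subr0. Qed.

Lemma Re_sum (I : Type) (s : seq I) (P : pred I) (F : I -> C) :
  Re (\sum_(i <- s | P i) F i) = \sum_(i <- s | P i) Re (F i).
Proof. by apply: (big_morph _ ReD). Qed.

Lemma abs2E (z : C) : abs2 z = Re ((z^*)%R * z).
Proof. by rewrite /abs2 normCKC. Qed.

Lemma abs2_ge0 (z : C) : 0 <= abs2 z.
Proof. by rewrite abs2E; case: z => x y /=; rewrite mulNr opprK addr_ge0 // -expr2 sqr_ge0. Qed.

Lemma abs2C (z : C) : ((z^*)%R * z) = (abs2 z)%:C.
Proof.
rewrite abs2E; case: z => x y; apply/eqP; rewrite eq_complex /= eqxx /=.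
by apply/eqP; ring.
Qed.

Lemma abs2_conj (z : C) : abs2 (z^*)%R = abs2 z.
Proof. by rewrite !abs2E conjCK mulrC. Qed.

Lemma conjC_real (a : R) : ((a%:C)^*)%R = a%:C :> C.
Proof. by rewrite conjCE conjc_real. Qed.

Lemma Re_le (x y : C) : x <= y -> Re x <= Re y.
Proof. by rewrite lecE => /andP[]. Qed.

Lemma sum_real_complex (I : Type) (s : seq I) (P : pred I) (F : I -> R) :
  \sum_(i <- s | P i) (F i)%:C = (\sum_(i <- s | P i) F i)%:C :> C.
Proof. by rewrite rmorph_sum. Qed.

Lemma ge0_ReE (z : C) : 0 <= z -> (Re z)%:C = z.
Proof. by move=> z0; rewrite RRe_real // ger0_real. Qed.

End ComplexFacts.

(** * Riemann sums for the relative entropy of two numbers *)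

Section Riemann.
Variable R : realType.

Lemma ln_sub_ge (x y : R) : 0 < x -> 0 < y -> (y - x) / y <= ln y - ln x.
Proof.
move=> x0 y0; have : ln (x / y) <= x / y - 1.
  have h : -1 < x / y - 1 by rewrite -[ltLHS]add0r ltrD2r divr_gt0.
  by have := le_ln1Dx h; rewrite addrCA subrr addr0.
rewrite ln_div ?posrE // => h.
by rewrite mulrBl divff ?gt_eqF //; lra.
Qed.

Lemma ln_sub_le (x y : R) : 0 < x -> 0 < y -> ln y - ln x <= (y - x) / x.
Proof. by move=> x0 y0; have := ln_sub_ge y0 x0; rewrite !mulrBl !divff ?gt_eqF //; lra. Qed.

(** Right endpoints keep [u] away from 0, where the factor [1/u] of the integrand is undefined, and
    make the sum err on the upper side only. *)
Definition node (N k : nat) : R := k.+1%:R / N%:R.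

Lemma node_gt0 N k : (0 < N)%N -> 0 < node N k.
Proof. by move=> N0; rewrite divr_gt0 // ltr0n. Qed.

Lemma node_le1 N k : (0 < N)%N -> (k < N)%N -> node N k <= 1.
Proof. by move=> N0 kN; rewrite ler_pdivrMr ?ltr0n // mul1r ler_nat. Qed.

(** The factor [(N u)^-1] is the cell width [1/N] times the [1/u] of the integrand. *)
Definition rsum (N : nat) (r s : R) : R :=
  \sum_(k < N) (N%:R * node N k)^-1 * (r ^+ 2 / (node N k * s + (1 - node N k) * r) - r).

(* With a_k = r + (k/N)(s - r), the sum is - r * \sum_k (a_{k+1} - a_k) / a_{k+1},
   a right Riemann sum of - r * \int_r^s dx / x. *)
Lemma rsum_bounds N r s : (0 < N)%N -> 0 <= r -> 0 < s ->
  r * ln r - r * ln s <= rsum N r s <= r * ln r - r * ln s + (s - r) ^+ 2 / s / N%:R.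
Proof.
move=> N0 r0 s0.
have Np : 0 < N%:R :> R by rewrite ltr0n.
have Nn : N%:R != 0 :> R by rewrite gt_eqF.
have sn : s != 0 by rewrite gt_eqF.
move: r0; rewrite le_eqVlt => /orP[/eqP<-|r0].
  rewrite /rsum big1 => [|k _]; last by rewrite expr0n /= mul0r subrr mulr0.
  by rewrite !mul0r subrr lexx add0r subr0 !divr_ge0 ?sqr_ge0 // ltW.
have rn : r != 0 by rewrite gt_eqF.
pose a k : R := r + k%:R / N%:R * (s - r).
have a_gt0 k : (k <= N)%N -> 0 < a k.
  move=> kN; have h1 : k%:R / N%:R <= 1 :> R by rewrite ler_pdivrMr // mul1r ler_nat.
  have h0 : 0 <= k%:R / N%:R :> R by rewrite divr_ge0.
  rewrite /a; move: (k%:R / N%:R) h0 h1 => u u0 u1.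
  have -> : r + u * (s - r) = (1 - u) * r + u * s by ring.
  move: u0; rewrite le_eqVlt => /orP[/eqP<-|u0]; first by rewrite subr0 mul1r mul0r addr0.
  by rewrite ltr_wpDl ?mulr_gt0 // mulr_ge0 ?subr_ge0 // ltW.
have a0 : a 0%N = r by rewrite /a mul0r mul0r addr0.
have aN : a N = s by rewrite /a divff // mul1r addrCA subrr addr0.
have aS k : a k.+1 - a k = (s - r) / N%:R.
  by rewrite /a -natr1; field.
have rsE : rsum N r s = - r * \sum_(k < N) (a k.+1 - a k) / a k.+1.
  rewrite /rsum mulr_sumr; apply: eq_bigr => k _; rewrite aS.
  have ak := a_gt0 k.+1 (ltn_ord k).
  have un : node N k != 0 by rewrite gt_eqF // node_gt0.
  move: ak; rewrite /a -/(node N k) => /lt0r_neq0 ak.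
  have -> : node N k * s + (1 - node N k) * r = r + node N k * (s - r) by ring.
  by field; rewrite un Nn ak.
have lnE : ln s - ln r = \sum_(k < N) (ln (a k.+1) - ln (a k)).
  rewrite -(big_mkord xpredT (fun k => ln (a k.+1) - ln (a k))).
  by rewrite telescope_sumr // a0 aN.
rewrite rsE; apply/andP; split.
  have : \sum_(k < N) (a k.+1 - a k) / a k.+1 <= ln s - ln r.
    rewrite lnE; apply: ler_sum => k _; apply: ln_sub_ge; apply: a_gt0 => //.
    exact: ltnW.
  by move=> /(ler_wpM2l (ltW r0)); rewrite mulrBr mulNr; lra.
have h : ln s - ln r <= \sum_(k < N) (a k.+1 - a k) / a k.
  rewrite lnE; apply: ler_sum => k _; apply: ln_sub_le; apply: a_gt0 => //.
  exact: ltnW.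
(* The cells have equal width, so the right and left sums differ by a telescoping sum of inverses;
   this is the source of the error of order [1/N]. *)
have E : \sum_(k < N) (a k.+1 - a k) / a k.+1 =
    \sum_(k < N) (a k.+1 - a k) / a k - (s - r) ^+ 2 / s / N%:R / r.
  have -> : (s - r) ^+ 2 / s / N%:R / r = (s - r) / N%:R * - ((a N)^-1 - (a 0%N)^-1).
    by rewrite a0 aN; field; rewrite sn rn Nn.
  rewrite -(telescope_sumr (fun k => (a k)^-1)) // big_mkord -sumrN mulr_sumr.
  rewrite -sumrB; apply: eq_bigr => k _; rewrite aS; ring.
have := ler_wpM2l (ltW r0) h.
have : r * ((s - r) ^+ 2 / s / N%:R / r) = (s - r) ^+ 2 / s / N%:R.
  by rewrite mulrC divfK.
by rewrite E !mulrBr !mulNr; lra.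
Qed.

End Riemann.

(** * A variational formula and its monotonicity under channels *)

Section MatrixDPI.
Variable R : realType.
Local Notation C := R[i].
Local Notation Re := complex.Re.

Lemma adjM m n p (A : 'M[C]_(m, n)) (B : 'M[C]_(n, p)) :
  (A *m B)^t* = B^t* *m A^t*.
Proof. by rewrite trmx_mul map_mxM. Qed.

Lemma adjE m n (A : 'M[C]_(m, n)) i j : (A^t*) i j = (A j i)^*%R.
Proof. by rewrite !mxE. Qed.

Lemma adjB m n (A B : 'M[C]_(m, n)) : (A - B)^t* = A^t* - B^t*.
Proof. by rewrite linearB map_mxB. Qed.

Lemma adj_sum m n (I : finType) (A : I -> 'M[C]_(m, n)) :
  (\sum_i A i)^t* = \sum_i (A i)^t*.
Proof. by rewrite linear_sum (raddf_sum (map_mx Num.conj)). Qed.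

Definition rdiag n (r : 'I_n -> R) : 'M[C]_n := diag_mx (\row_i (r i)%:C).

Lemma adj_rdiag n (r : 'I_n -> R) : (rdiag r)^t* = rdiag r.
Proof.
rewrite /rdiag tr_diag_mx map_diag_mx; congr diag_mx.
by apply/rowP => i; rewrite !mxE; exact: conjC_real.
Qed.

Lemma mul_rdiagE k l (s : 'I_l -> R) (A : 'M[C]_(l, k)) j i :
  (rdiag s *m A) j i = (s j)%:C * A j i.
Proof. by rewrite mul_diag_mx !mxE. Qed.

Lemma mulmx_rdiagE k l (r : 'I_k -> R) (A : 'M[C]_(l, k)) j i :
  (A *m rdiag r) j i = A j i * (r i)%:C.
Proof. by rewrite mul_mx_diag !mxE. Qed.

(** A spectral decomposition; the rows of [U] are the adjoints of the eigenvectors. The two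
    unitarity equations force [k = n], but separate sizes let an eigenbasis be indexed by another
    finite type without casts. *)
Definition sdec k n (rho : 'M[C]_n) (r : 'I_k -> R) (U : 'M[C]_(k, n)) : Prop :=
  [/\ U *m U^t* = 1%:M, U^t* *m U = 1%:M & rho = U^t* *m rdiag r *m U].

Definition vfun n (u : R) (Y rho sigma : 'M[C]_n) : R :=
  2 * Re (\tr (Y^t* *m rho)) - u * Re (\tr (Y^t* *m sigma *m Y))
  - (1 - u) * Re (\tr (Y *m rho *m Y^t*)).

Lemma tr_adj_rdiag k l (s : 'I_l -> R) (Z : 'M[C]_(l, k)) :
  Re (\tr (Z^t* *m rdiag s *m Z)) = \sum_j \sum_i s j * abs2 (Z j i).
Proof.
rewrite exchange_big /mxtrace Re_sum; apply: eq_bigr => i _.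
rewrite mxE Re_sum; apply: eq_bigr => j _; rewrite mul_mx_diag !mxE.
by rewrite [_ * (s j)%:C]mulrC -mulrA ReZ abs2E.
Qed.

Lemma tr_rdiag_adj k l (r : 'I_k -> R) (Z : 'M[C]_(l, k)) :
  Re (\tr (Z *m rdiag r *m Z^t*)) = \sum_j \sum_i r i * abs2 (Z j i).
Proof.
rewrite /mxtrace Re_sum; apply: eq_bigr => j _.
rewrite mxE Re_sum; apply: eq_bigr => i _; rewrite mul_mx_diag !mxE.
by rewrite [_ * (r i)%:C]mulrC -mulrA ReZ abs2E [(_^*)%R * _]mulrC.
Qed.

Lemma tr_adj_mul_rdiag k l (r : 'I_k -> R) (Z W : 'M[C]_(l, k)) :
  Re (\tr (Z^t* *m (W *m rdiag r))) =
  \sum_j \sum_i r i * Re ((Z j i)^*%R * W j i).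
Proof.
rewrite exchange_big /mxtrace Re_sum; apply: eq_bigr => i _.
rewrite mxE Re_sum; apply: eq_bigr => j _; rewrite mul_mx_diag !mxE.
by rewrite mulrA [_ * (r i)%:C]mulrC ReZ.
Qed.

(** Expressing [Y] in the two eigenbases decouples the quadratic functional into one scalar problem
    for each entry [Z j i]. *)
Lemma vfun_diag k l n (u : R) (rho sigma : 'M[C]_n) r U s V (Z : 'M[C]_(l, k)) :
  sdec rho r U -> sdec sigma s V ->
  vfun u (V^t* *m Z *m U) rho sigma = \sum_j \sum_i
    (2 * (r i * Re ((Z j i)^*%R * (V *m U^t*) j i))
     - (u * s j + (1 - u) * r i) * abs2 (Z j i)).
Proof.
move=> [UU UU' rhoE] [VV VV' sigmaE]; rewrite /vfun.
have -> : \tr ((V^t* *m Z *m U)^t* *m rho) = \tr (Z^t* *m (V *m U^t* *m rdiag r)).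
  rewrite !adjM trmxCK rhoE mxtrace_mulC !mulmxA -[_ *m U *m U^t*]mulmxA UU mulmx1.
  by rewrite mxtrace_mulC !mulmxA [LHS]mxtrace_mulC !mulmxA.
have -> : \tr ((V^t* *m Z *m U)^t* *m sigma *m (V^t* *m Z *m U)) =
          \tr (Z^t* *m rdiag s *m Z).
  rewrite !adjM trmxCK sigmaE !mulmxA mxtrace_mulC !mulmxA UU mul1mx.
  rewrite -[_ *m V *m V^t*]mulmxA VV mulmx1 -[_ *m V *m V^t*]mulmxA VV mulmx1.
  by [].
have -> : \tr (V^t* *m Z *m U *m rho *m (V^t* *m Z *m U)^t*) =
          \tr (Z *m rdiag r *m Z^t*).
  rewrite !adjM trmxCK rhoE !mulmxA mxtrace_mulC !mulmxA VV mul1mx.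
  by rewrite -[_ *m U *m U^t*]mulmxA UU mulmx1 -[_ *m U *m U^t*]mulmxA UU mulmx1.
rewrite tr_adj_mul_rdiag tr_adj_rdiag tr_rdiag_adj !mulr_sumr -!sumrB.
apply: eq_bigr => j _; rewrite !mulr_sumr -!sumrB.
by apply: eq_bigr => i _; ring.
Qed.

(** Completing the square: the gap is the squared modulus of [r w - c z] divided by [c], so equality
    holds at [z = (r / c) w]. *)
Lemma completion_le (r c : R) (w z : C) : 0 < c ->
  2 * (r * Re (z^*%R * w)) - c * abs2 z <= abs2 w * (r ^+ 2 / c).
Proof.
move=> c0; rewrite !abs2E !conjCE; case: w z => [a b] [x y] /=.
have -> : (a * a - - b * b) * (r ^+ 2 / c) = (r^+2 * (a ^+ 2 + b ^+ 2)) / c by ring.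
rewrite ler_pdivlMr // -subr_ge0.
rewrite (_ : _ - _ = (r * a - c * x) ^+ 2 + (r * b - c * y) ^+ 2); last by ring.
by rewrite addr_ge0 ?sqr_ge0.
Qed.

Lemma completion_eq (r c : R) (w : C) : 0 < c ->
  2 * (r * Re (((r / c)%:C * w)^*%R * w)) - c * abs2 ((r / c)%:C * w)
  = abs2 w * (r ^+ 2 / c).
Proof.
move=> c0; rewrite !abs2E !conjCE; case: w => [a b] /=.
by field; rewrite gt_eqF.
Qed.

(** The closed form of the supremum of [vfun u] over [Y], where [W] is the overlap matrix of the two
    eigenbases; [vfun_le] and [vfun_attained] prove this. *)
Definition qfun k l (u : R) (r : 'I_k -> R) (s : 'I_l -> R) (W : 'M[C]_(l, k)) : R :=
  \sum_j \sum_i abs2 (W j i) * (r i ^+ 2 / (u * s j + (1 - u) * r i)).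

Lemma mix_gt0 (u r s : R) : 0 < u -> u <= 1 -> 0 <= r -> 0 < s ->
  0 < u * s + (1 - u) * r.
Proof. by move=> u0 u1 r0 s0; rewrite ltr_wpDr ?mulr_gt0 // mulr_ge0 // subr_ge0. Qed.

Lemma vfun_le k l n (u : R) (rho sigma Y : 'M[C]_n) (r : 'I_k -> R) U (s : 'I_l -> R) V :
  0 < u -> u <= 1 -> (forall i, 0 <= r i) -> (forall j, 0 < s j) ->
  sdec rho r U -> sdec sigma s V ->
  vfun u Y rho sigma <= qfun u r s (V *m U^t*).
Proof.
move=> u0 u1 r0 s0 dr ds.
have -> : Y = V^t* *m (V *m Y *m U^t*) *m U.
  case: dr ds => [_ UU _] [_ VV _].
  by rewrite !mulmxA VV mul1mx -mulmxA UU mulmx1.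
rewrite (vfun_diag _ _ dr ds); apply: ler_sum => j _; apply: ler_sum => i _.
exact/completion_le/mix_gt0.
Qed.

Lemma vfun_attained k l n (u : R) (rho sigma : 'M[C]_n) (r : 'I_k -> R) U (s : 'I_l -> R) V :
  0 < u -> u <= 1 -> (forall i, 0 <= r i) -> (forall j, 0 < s j) ->
  sdec rho r U -> sdec sigma s V ->
  exists Y, vfun u Y rho sigma = qfun u r s (V *m U^t*).
Proof.
move=> u0 u1 r0 s0 dr ds.
pose Z : 'M[C]_(l, k) :=
  \matrix_(j, i) ((r i / (u * s j + (1 - u) * r i))%:C * (V *m U^t*) j i).
exists (V^t* *m Z *m U); rewrite (vfun_diag _ _ dr ds).
apply: eq_bigr => j _; apply: eq_bigr => i _.
by rewrite [Z j i]mxE completion_eq // mix_gt0.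
Qed.

(** Testing against rectangular [Y] under a trace lets both single vectors and whole matrices be
    inserted directly. *)
Definition posmx n (A : 'M[C]_n) : Prop :=
  forall p (Y : 'M[C]_(n, p)), 0 <= Re (\tr (Y^t* *m A *m Y)).

Lemma sdec_posmx k n (rho : 'M[C]_n) (r : 'I_k -> R) U :
  (forall i, 0 <= r i) -> sdec rho r U -> posmx rho.
Proof.
move=> r0 [_ _ ->] p Y.
have -> : Y^t* *m (U^t* *m rdiag r *m U) *m Y = (U *m Y)^t* *m rdiag r *m (U *m Y).
  by rewrite adjM !mulmxA.
by rewrite tr_adj_rdiag; do 2!apply: sumr_ge0 => ? _; rewrite mulr_ge0 ?abs2_ge0.
Qed.

Section Kraus.
Variables (n p : nat) (I : finType) (K : I -> 'M[C]_(p, n)).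
Hypothesis K1 : \sum_i (K i)^t* *m K i = 1%:M.

(** The channel and, below, its adjoint for the trace pairing. [K1] makes the channel trace
    preserving and the adjoint unital. *)
Definition kraus (A : 'M[C]_n) : 'M[C]_p := \sum_i K i *m A *m (K i)^t*.
Definition krausD (Y : 'M[C]_p) : 'M[C]_n := \sum_i (K i)^t* *m Y *m K i.

Lemma adj_krausD Y : (krausD Y)^t* = krausD (Y^t*).
Proof.
by rewrite adj_sum; apply: eq_bigr => i _; rewrite !adjM trmxCK mulmxA.
Qed.

Lemma tr_krausD A Y : \tr (krausD Y *m A) = \tr (Y *m kraus A).
Proof.
rewrite mulmx_suml mulmx_sumr !linear_sum /=; apply: eq_bigr => i _.
by rewrite -!mulmxA [LHS]mxtrace_mulC !mulmxA.
Qed.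

(* Kadison-Schwarz, from positivity of \sum_i X_i A X_i^t*
   with X_i = Y^t* K_i - K_i T^t* and T the image of Y. *)
Lemma krausD_schwarz A Y : posmx A -> A^t* = A ->
  Re (\tr ((krausD Y)^t* *m A *m krausD Y)) <= Re (\tr (Y^t* *m kraus A *m Y)).
Proof.
move=> A0 Ah; set T := krausD Y.
have : 0 <= \sum_i Re (\tr ((Y^t* *m K i - K i *m T^t*) *m A *m
                         (Y^t* *m K i - K i *m T^t*)^t*)).
  apply: sumr_ge0 => i _; set X := (_ - _).
  by have := A0 _ (X^t*); rewrite trmxCK.
rewrite -Re_sum -linear_sum.
have -> : \sum_i (Y^t* *m K i - K i *m T^t*) *m A *m
                   (Y^t* *m K i - K i *m T^t*)^t* =
   Y^t* *m kraus A *m Y - Y^t* *m (\sum_i K i *m (A *m T) *m (K i)^t*)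
    - (\sum_i K i *m (T^t* *m A) *m (K i)^t*) *m Y
    + \sum_i K i *m (T^t* *m A *m T) *m (K i)^t*.
  rewrite /kraus mulmx_sumr !mulmx_suml mulmx_sumr -!sumrB -big_split /=.
  apply: eq_bigr => i _; rewrite adjB !adjM !trmxCK !mulmxBl !mulmxBr !mulmxA.
  by rewrite opprB addrA addrAC.
have h B : \tr (\sum_i K i *m B *m (K i)^t*) = \tr B.
  rewrite linear_sum /= -[in RHS](mulmx1 B) -K1 mulmx_sumr linear_sum /=.
  by apply: eq_bigr => i _; rewrite -mulmxA [LHS]mxtrace_mulC -mulmxA.
rewrite !linearD !linearN /= h.
rewrite -[\sum_i K i *m (A *m T) *m _]/(kraus _) -tr_krausD -adj_krausD mulmxA.
rewrite [\tr (_ *m Y)]mxtrace_mulC.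
rewrite -[\sum_i K i *m (T^t* *m A) *m _]/(kraus _) -tr_krausD -/T.
rewrite [\tr (T *m _)]mxtrace_mulC addrNK subr_ge0; exact.
Qed.

(** The optimal [Y] for the output pair, pulled back by [krausD], competes in the supremum for the
    input pair. Duality preserves the linear term, and the Kadison-Schwarz inequality keeps both
    subtracted quadratic terms from growing. *)
Lemma qfun_mono k l k' l' (u : R) (rho sigma : 'M[C]_n) (sigma' : 'M[C]_p)
  (r : 'I_k -> R) U (s : 'I_l -> R) V (r' : 'I_k' -> R) U' (s' : 'I_l' -> R) V' :
  0 < u -> u <= 1 ->
  (forall i, 0 <= r i) -> (forall j, 0 < s j) ->
  (forall i, 0 <= r' i) -> (forall j, 0 < s' j) ->
  sdec rho r U -> sdec sigma s V -> sdec (kraus rho) r' U' -> sdec sigma' s' V' ->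
  posmx (sigma' - kraus sigma) ->
  qfun u r' s' (V' *m U'^t*) <= qfun u r s (V *m U^t*).
Proof.
move=> u0 u1 r0 s0 r'0 s'0 dr ds dr' ds' le_s.
have [Y <-] := vfun_attained u0 u1 r'0 s'0 dr' ds'.
apply: (le_trans _ (vfun_le (krausD Y) u0 u1 r0 s0 dr ds)).
have hrho : rho^t* = rho.
  by case: dr => _ _ ->; rewrite !adjM trmxCK adj_rdiag mulmxA.
have hsig : sigma^t* = sigma.
  by case: ds => _ _ ->; rewrite !adjM trmxCK adj_rdiag mulmxA.
have h1 : Re (\tr ((krausD Y)^t* *m sigma *m krausD Y)) <=
          Re (\tr (Y^t* *m sigma' *m Y)).
  apply: (le_trans (krausD_schwarz _ _ _)) => //.
    by apply: sdec_posmx ds => j; exact: ltW.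
  by have := le_s _ Y; rewrite mulmxBr mulmxBl linearB ReB subr_ge0.
(* Here [rho] stands on the other side of [Y], so the Schwarz inequality is applied to the adjoint
   of [Y]. *)
have h2 : Re (\tr (krausD Y *m rho *m (krausD Y)^t*)) <=
          Re (\tr (Y *m kraus rho *m Y^t*)).
  have := @krausD_schwarz rho (Y^t*) (sdec_posmx r0 dr) hrho.
  by rewrite -adj_krausD !trmxCK.
have h3 : Re (\tr ((krausD Y)^t* *m rho)) = Re (\tr (Y^t* *m kraus rho)).
  by rewrite adj_krausD tr_krausD.
have := ler_wpM2l (ltW u0) h1; have := ler_wpM2l (_ : 0 <= 1 - u) h2.
by rewrite subr_ge0 => /(_ u1); rewrite /vfun h3; lra.
Qed.

End Kraus.
End MatrixDPI.

(** * Passing to the limit in inequalities *)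

Section Limits.
Variable R : realType.

(** Leaving the sign of [K] free, here and in the next lemma, lets error constants be inserted
    without a proof that they are nonnegative. *)
Lemma le_of_add_eps (x y K : R) : (forall e, 0 < e -> x <= y + e * K) -> x <= y.
Proof.
move=> h; apply/ler_addgt0Pr => e e0.
have [K0|K0] := leP K 0.
  by apply: (le_trans (h 1 ltr01)); rewrite lerD2l mul1r (le_trans K0) ?ltW.
apply: (le_trans (h (e / K) _)); first by rewrite divr_gt0.
by rewrite divfK // gt_eqF.
Qed.

Lemma le_of_add_invn (x y K : R) :
  (forall N, (0 < N)%N -> x <= y + K / N%:R) -> x <= y.
Proof.
move=> h; apply/ler_addgt0Pr => e e0.
have [K0|K0] := leP K 0.
  by apply: (le_trans (h 1%N isT)); rewrite lerD2l divr1 (le_trans K0) ?ltW.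
have Ke : 0 <= K / e by rewrite divr_ge0 // ltW.
apply: (le_trans (h (Num.bound (K / e)).+1 isT)); rewrite lerD2l.
rewrite ler_pdivrMr ?ltr0n // mulrC -ler_pdivrMr //.
apply: ltW; apply: (lt_le_trans (archi_boundP Ke)).
by rewrite ler_nat.
Qed.

Lemma ln_add_le (s e : R) : 0 < s -> 0 <= e -> ln (s + e) <= ln s + e / s.
Proof.
move=> s0 e0; have se : 0 < s + e by rewrite ltr_wpDr.
by have := ln_sub_le s0 se; rewrite addrAC subrr add0r; lra.
Qed.

End Limits.

(** * Monotonicity of the relative entropy *)

Section RelativeEntropy.
Variable R : realType.
Local Notation C := R[i].
Local Notation Re := complex.Re.

(** The relative entropy with natural logarithms, weighted by the squared overlaps of the
    eigenbases; in this form the scalar Riemann bounds apply term by term. *)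
Definition relD k l (r : 'I_k -> R) (s : 'I_l -> R) (W : 'M[C]_(l, k)) : R :=
  \sum_j \sum_i abs2 (W j i) * (r i * ln (r i) - r i * ln (s j)).

Lemma sdec_trace k n (rho : 'M[C]_n) (r : 'I_k -> R) U :
  sdec rho r U -> Re (\tr rho) = \sum_i r i.
Proof.
move=> [UU _ ->]; rewrite mxtrace_mulC mulmxA UU mul1mx /mxtrace Re_sum.
by apply: eq_bigr => i _; rewrite !mxE eqxx mulr1n.
Qed.

Lemma sdec_shift k n (rho : 'M[C]_n) (r : 'I_k -> R) U e :
  sdec rho r U -> sdec (rho + (e%:C)%:M) (fun i => r i + e) U.
Proof.
move=> [UU UU' rhoE]; split=> //.
have -> : rdiag (fun i => r i + e) = rdiag r + (e%:C)%:M :> 'M[C]_k.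
  apply/matrixP => i j; rewrite !mxE -mulrnDl; congr (_ *+ _).
  by rewrite rmorphD.
by rewrite mulmxDr mulmxDl -rhoE mul_mx_scalar -scalemxAl UU' scalemx1.
Qed.

Section Overlap.
Variables (k l n : nat) (rho sigma : 'M[C]_n).
Variables (r : 'I_k -> R) (U : 'M[C]_(k, n)) (s : 'I_l -> R) (V : 'M[C]_(l, n)).
Hypotheses (dr : sdec rho r U) (ds : sdec sigma s V).
Let W := V *m U^t*.

Lemma overlap_sum i : \sum_j abs2 (W j i) = 1.
Proof.
have : W^t* *m W = 1%:M.
  case: dr ds => [UU _ _] [_ VV _].
  by rewrite /W adjM trmxCK mulmxA -[U *m _ *m _]mulmxA VV mulmx1.
move/matrixP => /(_ i i); rewrite !mxE eqxx => /(congr1 (@complex.Re R)).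
rewrite Re_sum /= => <-; apply: eq_bigr => j _.
by rewrite adjE abs2E.
Qed.

Lemma overlap_diag j : \sum_i abs2 (W j i) * r i = Re ((V *m rho *m V^t*) j j).
Proof.
have -> : V *m rho *m V^t* = W *m rdiag r *m W^t*.
  by case: dr => _ _ ->; rewrite /W adjM trmxCK !mulmxA.
rewrite mxE Re_sum; apply: eq_bigr => i _.
by rewrite mul_mx_diag adjE mxE [X in _ * X * _]mxE mulrAC
  [X in Re X]mulrC ReZ abs2E mulrC [(_^*)%R * _]mulrC.
Qed.

Lemma overlap_mass : \sum_j \sum_i abs2 (W j i) * r i = Re (\tr rho).
Proof.
rewrite exchange_big /= (sdec_trace dr); apply: eq_bigr => i _.
by rewrite -mulr_suml overlap_sum mul1r.
Qed.

(** The first part is minus the entropy of [rho]; the second sees only the diagonal of [rho] in the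
    eigenbasis of [sigma]. *)
Lemma relDE : relD r s W =
  \sum_i r i * ln (r i) - \sum_j Re ((V *m rho *m V^t*) j j) * ln (s j).
Proof.
have -> : \sum_i r i * ln (r i) = \sum_j \sum_i abs2 (W j i) * (r i * ln (r i)).
  rewrite exchange_big /=; apply: eq_bigr => i _.
  by rewrite -mulr_suml overlap_sum mul1r.
rewrite -sumrB; apply: eq_bigr => j _.
rewrite -overlap_diag mulr_suml -sumrB; apply: eq_bigr => i _.
by rewrite mulrBr !mulrA.
Qed.

(** Exchanging the sums leaves one [qfun] per node, to which [qfun_mono] applies; the subtracted [r]
    adds up to the trace, which the channel preserves. *)
Lemma rsum_qfun N : \sum_j \sum_i abs2 (W j i) * rsum N (r i) (s j) =
  \sum_(m < N) (N%:R * node R N m)^-1 * (qfun (node R N m) r s W - Re (\tr rho)).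
Proof.
rewrite -overlap_mass.
transitivity (\sum_j \sum_i \sum_(m < N) (N%:R * node R N m)^-1 * (abs2 (W j i) *
   (r i ^+ 2 / (node R N m * s j + (1 - node R N m) * r i)) - abs2 (W j i) * r i)).
  apply: eq_bigr => j _; apply: eq_bigr => i _; rewrite mulr_sumr.
  by apply: eq_bigr => m _; rewrite -mulrBr mulrCA.
under eq_bigr do rewrite exchange_big.
rewrite exchange_big; apply: eq_bigr => m _; rewrite /qfun -sumrB mulr_sumr.
by apply: eq_bigr => j _; rewrite -sumrB mulr_sumr.
Qed.

End Overlap.

Section Monotone.
Variables (n p : nat) (I : finType) (K : I -> 'M[C]_(p, n)).
Hypothesis K1 : \sum_i (K i)^t* *m K i = 1%:M.
Variables (k l k' l' : nat) (rho : 'M[C]_n).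
Variables (r : 'I_k -> R) (U : 'M[C]_(k, n)) (V : 'M[C]_(l, n)).
Variables (r' : 'I_k' -> R) (U' : 'M[C]_(k', p)) (V' : 'M[C]_(l', p)).
Hypotheses (r0 : forall i, 0 <= r i) (r'0 : forall i, 0 <= r' i).
Hypotheses (dr : sdec rho r U) (dr' : sdec (kraus K rho) r' U').

Lemma tr_kraus : \tr (kraus K rho) = \tr rho.
Proof.
rewrite -[kraus _ _]mul1mx -tr_krausD /krausD; under eq_bigr do rewrite mulmx1.
by rewrite K1 mul1mx.
Qed.

(** The output relative entropy is at most its Riemann sum, which is node by node at most that of
    the input, which exceeds the input relative entropy by at most [E / N]. *)
Lemma relD_mono_pos (s : 'I_l -> R) (s' : 'I_l' -> R) (sigma : 'M[C]_n) (sigma' : 'M[C]_p) :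
  (forall j, 0 < s j) -> (forall j, 0 < s' j) ->
  sdec sigma s V -> sdec sigma' s' V' ->
  posmx (sigma' - kraus K sigma) ->
  relD r' s' (V' *m U'^t*) <= relD r s (V *m U^t*).
Proof.
move=> s0 s'0 ds ds' le_s.
set W := V *m U^t*; set W' := V' *m U'^t*.
pose E := \sum_j \sum_i abs2 (W j i) * ((s j - r i) ^+ 2 / s j).
apply: (le_of_add_invn (K := E)) => N N0.
apply: (@le_trans _ _ (\sum_j \sum_i abs2 (W' j i) * rsum N (r' i) (s' j))).
  apply: ler_sum => j _; apply: ler_sum => i _; rewrite ler_wpM2l ?abs2_ge0 //.
  by have /andP[] := rsum_bounds N0 (r'0 i) (s'0 j).
apply: (@le_trans _ _ (\sum_j \sum_i abs2 (W j i) * rsum N (r i) (s j))).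
  rewrite (rsum_qfun dr' ds') (rsum_qfun dr ds) tr_kraus.
  apply: ler_sum => m _; rewrite ler_wpM2l //.
    by rewrite invr_ge0 mulr_ge0 // ltW // node_gt0.
  rewrite lerD2r.
  by apply: (qfun_mono K1 _ _ r0 s0 r'0 s'0 dr ds dr' ds' le_s);
    [exact: node_gt0 | exact: node_le1].
rewrite mulr_suml -big_split /=; apply: ler_sum => j _.
rewrite mulr_suml -big_split /=; apply: ler_sum => i _.
rewrite -mulrA -mulrDr ler_wpM2l ?abs2_ge0 //.
by have /andP[] := rsum_bounds N0 (r0 i) (s0 j).
Qed.

Lemma posmxD m (A B : 'M[C]_m) : posmx A -> posmx B -> posmx (A + B).
Proof.
by move=> hA hB q Y; rewrite mulmxDr mulmxDl linearD ReD addr_ge0 // ?hA ?hB.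
Qed.

Lemma posmxZ m (a : R) (A : 'M[C]_m) : 0 <= a -> posmx A -> posmx (a%:C *: A).
Proof.
by move=> a0 hA q Y; rewrite -scalemxAr -scalemxAl linearZ /= ReZ mulr_ge0 // hA.
Qed.

Lemma diag_ge0 m q (A : 'M[C]_m) (X : 'M[C]_(q, m)) j :
  posmx A -> 0 <= Re ((X *m A *m X^t*) j j).
Proof.
move=> hA; have := hA _ ((row j X)^t*); rewrite trmxCK /mxtrace big_ord1.
suff -> : (row j X *m A *m (row j X)^t*) ord0 ord0 = (X *m A *m X^t*) j j by [].
rewrite -row_mul [LHS]mxE [RHS]mxE; apply: eq_bigr => i _.
by rewrite !adjE [row j X _ i]mxE [row j _ _ i]mxE.
Qed.

(** Zero eigenvalues of [sigma] and [sigma'] are removed by adding [e] and [kappa * e]; since the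
    channel maps 1 below [kappa], domination survives. The support conditions give weight zero to
    every term containing [ln 0], whatever its value, and then [e] tends to 0. *)
Theorem relD_mono (s : 'I_l -> R) (s' : 'I_l' -> R) (sigma : 'M[C]_n) (sigma' : 'M[C]_p)
    (kappa : R) :
  0 < kappa -> posmx ((kappa%:C)%:M - kraus K 1%:M) ->
  (forall j, 0 <= s j) -> (forall j, 0 <= s' j) ->
  sdec sigma s V -> sdec sigma' s' V' ->
  posmx (sigma' - kraus K sigma) ->
  (forall j, s j = 0 -> Re ((V *m rho *m V^t*) j j) = 0) ->
  (forall j, s' j = 0 -> Re ((V' *m kraus K rho *m V'^t*) j j) = 0) ->
  \sum_i r' i * ln (r' i) - \sum_j Re ((V' *m kraus K rho *m V'^t*) j j) * ln (s' j)
  <= \sum_i r i * ln (r i) - \sum_j Re ((V *m rho *m V^t*) j j) * ln (s j).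
Proof.
move=> kappa0 hk s0 s'0 ds ds' le_s supp supp'.
(* On the output side the shift raises [ln (s' j)] by at most [kappa * e / s' j]. On the input side
   it only decreases the right-hand side, so no error arises there. *)
pose E := \sum_j Re ((V' *m kraus K rho *m V'^t*) j j) * (kappa / s' j).
apply: (le_of_add_eps (K := E)) => e e0.
have ds_e := sdec_shift e ds; have ds'_e := sdec_shift (kappa * e) ds'.
have le_e : posmx (sigma' + ((kappa * e)%:C)%:M - kraus K (sigma + (e%:C)%:M)).
  have -> : sigma' + ((kappa * e)%:C)%:M - kraus K (sigma + (e%:C)%:M) =
     (sigma' - kraus K sigma) + e%:C *: ((kappa%:C)%:M - kraus K 1%:M).
    rewrite scalerBr scale_scalar_mx -rmorphM mulrC /=.
    have -> : kraus K (sigma + (e%:C)%:M) = kraus K sigma + e%:C *: kraus K 1%:M.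
      rewrite /kraus scaler_sumr -big_split; apply: eq_bigr => i _ /=.
      by rewrite mulmxDr mulmxDl mul_mx_scalar mulmx1 -scalemxAl.
    by rewrite opprD addrACA.
  exact: (posmxD le_s (posmxZ (ltW e0) hk)).
have s_e j : 0 < s j + e by rewrite ltr_wpDl.
have s'_e j : 0 < s' j + kappa * e by rewrite ltr_wpDl // mulr_gt0.
have := relD_mono_pos s_e s'_e ds_e ds'_e le_e.
rewrite (relDE dr ds_e) (relDE dr' ds'_e) => h.
have prho := sdec_posmx r0 dr; have prho' := sdec_posmx r'0 dr'.
have h1 : \sum_j Re ((V *m rho *m V^t*) j j) * ln (s j)
       <= \sum_j Re ((V *m rho *m V^t*) j j) * ln (s j + e).
  apply: ler_sum => j _; have [sj|sj] := eqVneq (s j) 0; first by rewrite supp // !mul0r.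
  rewrite ler_wpM2l ?diag_ge0 // ler_ln ?posrE ?lerDl ?(ltW e0) //.
  by rewrite lt0r sj s0.
have h2 : \sum_j Re ((V' *m kraus K rho *m V'^t*) j j) * ln (s' j + kappa * e)
       <= \sum_j Re ((V' *m kraus K rho *m V'^t*) j j) * ln (s' j) + e * E.
  rewrite /E mulr_sumr -big_split; apply: ler_sum => j _ /=.
  have [sj|sj] := eqVneq (s' j) 0; first by rewrite supp' // !mul0r mulr0 addr0.
  rewrite mulrCA -mulrDr ler_wpM2l ?diag_ge0 //.
  rewrite mulrA [e * _]mulrC; apply: ln_add_le; first by rewrite lt0r sj s'0.
  by rewrite ltW // mulr_gt0.
lra.
Qed.
End Monotone.
End RelativeEntropy.

(** * Operators over finite types: spectra, entropy and data processing *)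

Section Operators.
Variable R : realType.
Local Notation C := R[i].
Local Notation Re := complex.Re.

Lemma sum_enum_val (V : zmodType) (T : finType) (F : T -> V) :
  \sum_(i < #|T|) F (enum_val i) = \sum_x F x.
Proof. by rewrite [RHS](reindex _ (onW_bij _ (@enum_val_bij T))). Qed.

Lemma sum3_last (V : zmodType) (I J K : finType) (F : I -> J -> K -> V) :
  \sum_i \sum_j \sum_k F i j k = \sum_k \sum_i \sum_j F i j k.
Proof. by under eq_bigr do rewrite exchange_big; rewrite exchange_big. Qed.

Definition mx (T U : finType) (f : T -> U -> C) : 'M[C]_(#|T|, #|U|) :=
  \matrix_(i, j) f (enum_val i) (enum_val j).

Lemma mxM (T U V : finType) (f : T -> U -> C) (g : U -> V -> C) :
  mx f *m mx g = mx (fun x z => \sum_y f x y * g y z).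
Proof.
apply/matrixP => i j; rewrite mxE [RHS]mxE -[RHS]sum_enum_val.
by apply: eq_bigr => k _; rewrite !mxE.
Qed.

Lemma mx_adj (T U : finType) (f : T -> U -> C) :
  (mx f)^t* = mx (fun y x => (f x y)^*%R).
Proof. by apply/matrixP => i j; rewrite !mxE. Qed.

Lemma eq_mx (T U : finType) (f g : T -> U -> C) :
  (forall x y, f x y = g x y) -> mx f = mx g.
Proof. by move=> h; apply/matrixP => i j; rewrite !mxE h. Qed.

Lemma mx_sum (I T U : finType) (f : I -> T -> U -> C) :
  \sum_i mx (f i) = mx (fun x y => \sum_i f i x y).
Proof.
by apply/matrixP => i j; rewrite summxE !mxE; apply: eq_bigr => k _; rewrite mxE.
Qed.

Lemma mx_scalar (T : finType) (a : C) : a%:M = mx (fun x y : T => a * (x == y)%:R).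
Proof.
by apply/matrixP => i j; rewrite !mxE (inj_eq enum_val_inj) mulr_natr.
Qed.

Definition qform (T : finType) (X : op R T) (v : T -> C) : C :=
  \sum_(x : T) \sum_(y : T) (v x)^* * X x y * v y.

Lemma mx_posmx (T : finType) (X : op R T) :
  (forall v, 0 <= Re (qform X v)) -> posmx (mx X).
Proof.
move=> h p Y; rewrite /mxtrace Re_sum; apply: sumr_ge0 => j _.
pose v x := Y (enum_rank x) j.
suff -> : (Y^t* *m mx X *m Y) j j = qform X v by exact: h.
rewrite mxE /qform exchange_big /= -[RHS]sum_enum_val; apply: eq_bigr => i _.
rewrite mxE mulr_suml -[RHS]sum_enum_val; apply: eq_bigr => k _.
by rewrite adjE !mxE /v !enum_valK.
Qed.

(** The index type [K] is independent of [T], so that product eigenbases can be indexed by pairs. *)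
Definition eigsys (T K : finType) (X : op R T) (l : K -> R) (v : K -> T -> C) : Prop :=
  [/\ forall k k', \sum_x (v k x)^* * v k' x = (k == k')%:R,
      forall x y, \sum_k v k x * (v k y)^* = (x == y)%:R
    & forall x y, X x y = \sum_k (l k)%:C * (v k x * (v k y)^*)].

Lemma eigsys_sdec (T K : finType) (X : op R T) (l : K -> R) (v : K -> T -> C) :
  eigsys X l v ->
  sdec (mx X) (fun i => l (enum_val i)) (mx (fun k x => (v k x)^*%R)).
Proof.
move=> [h1 h2 h3]; split.
- rewrite mx_adj mxM mx_scalar; apply: eq_mx => k k'; rewrite mul1r -h1.
  by apply: eq_bigr => x _; rewrite conjCK.
- rewrite mx_adj mxM mx_scalar; apply: eq_mx => x y; rewrite mul1r -h2.
  by apply: eq_bigr => k _; rewrite conjCK.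
have -> : rdiag (fun i => l (enum_val i)) =
    mx (fun k k' : K => (l k)%:C * (k == k')%:R).
  by apply/matrixP => i j; rewrite !mxE (inj_eq enum_val_inj) mulr_natr.
rewrite mx_adj !mxM; apply: eq_mx => x y; rewrite h3; apply: eq_bigr => k _.
rewrite (bigD1 k) //= big1 ?addr0 => [|k' /negPf kk']; last by rewrite kk' !mulr0.
by rewrite eqxx mulr1 conjCK mulrAC [RHS]mulrC mulrC.
Qed.

(** The overlap matrix intertwines the two diagonal matrices, so [W j i] is nonzero only if
    [r i = s j]; its squared moduli form a doubly stochastic matrix, which carries one sum to the
    other. *)
Lemma sdec_unique k l n (rho : 'M[C]_n) (r : 'I_k -> R) U (s : 'I_l -> R) V (f : R -> R) :
  sdec rho r U -> sdec rho s V -> \sum_i f (r i) = \sum_j f (s j).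
Proof.
move=> dr ds; set W := V *m U^t*.
have WE j i : (s j)%:C * W j i = W j i * (r i)%:C.
  have : rdiag s *m W = W *m rdiag r.
    have -> : rdiag s = V *m rho *m V^t*.
      case: ds => VV VV' ->.
      by rewrite !mulmxA VV mul1mx -mulmxA VV mulmx1.
    rewrite /W; case: ds dr => [_ VV _] [UU UU' ->].
    rewrite -!mulmxA [V^t* *m _]mulmxA VV mul1mx UU mulmx1.
    by rewrite !mulmxA.
  by move/matrixP => /(_ j i); rewrite mul_rdiagE mulmx_rdiagE.
have E j i : abs2 (W j i) * f (r i) = abs2 (W j i) * f (s j).
  have [->|Wn0] := eqVneq (W j i) 0.
    by rewrite abs2E mulr0 /= !mul0r.
  by have := WE j i; rewrite mulrC => /(mulfI Wn0) /complexI ->.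
transitivity (\sum_i \sum_j abs2 (W j i) * f (r i)).
  by apply: eq_bigr => i _; rewrite -mulr_suml (overlap_sum dr ds) mul1r.
rewrite exchange_big; apply: eq_bigr => j _ /=.
transitivity (\sum_i abs2 (W j i) * f (s j)); first by apply: eq_bigr => i _; rewrite E.
rewrite -mulr_suml -[RHS]mul1r -(overlap_sum ds dr j); congr (_ * _).
apply: eq_bigr => i _; rewrite -abs2_conj -adjE; congr (abs2 (_ i j)).
by rewrite /W adjM trmxCK.
Qed.

Lemma eigsys_herm (T K : finType) (X : op R T) (l : K -> R) v : eigsys X l v -> herm_op X.
Proof.
move=> [_ _ h] x y; rewrite !h rmorph_sum; apply: eq_bigr => k _ /=.
by rewrite !rmorphM /= conjC_real conjCK [v k x * _]mulrC.
Qed.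

(** The entropy formula holds here for the eigenbasis chosen by [spectralmx]; [entropyE] extends it
    to every eigenbasis. *)
Lemma herm_eigsys (T : finType) (X : op R T) : herm_op X ->
  exists (l : 'I_#|T| -> R) v, eigsys X l v /\ entropy X = - \sum_k l k * log2 (l k).
Proof.
move=> hX; pose A := mx_of X; pose P := spectralmx A; pose D := spectral_diag A.
have hA : A \is hermsymmx.
  apply/is_hermitianmxP; rewrite expr0 scale1r.
  by apply/matrixP => i j; rewrite !mxE hX.
have Dr k : (Re (D 0 k))%:C = D 0 k.
  by rewrite RRe_real //; have /mxOverP := hermitian_spectral_diag_real hA; apply.
have uP : P \is unitarymx := spectral_unitarymx A.
have AE : A = P^t* *m diag_mx D *m P.
  by rewrite -(invmx_unitary uP); apply/orthomx_spectralP/hermitian_normalmx.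
have PP : P *m P^t* = 1%:M by apply/unitarymxP.
have PP' : P^t* *m P = 1%:M by rewrite -(invmx_unitary uP) mulVmx // unitarymx_unit.
exists (fun k => Re (D 0 k)), (fun k x => (P k (enum_rank x))^*%R); split; first split.
- move=> k k'; have /matrixP/(_ k k') := PP; rewrite mxE [RHS]mxE => <-.
  rewrite -[LHS]sum_enum_val; apply: eq_bigr => i _.
  by rewrite enum_valK conjCK adjE.
- move=> x y; have /matrixP/(_ (enum_rank x) (enum_rank y)) := PP'.
  rewrite mxE [RHS]mxE (inj_eq enum_rank_inj) => <-.
  by apply: eq_bigr => k _; rewrite conjCK adjE.
- move=> x y; have := congr1 (fun M : 'M_#|T| => M (enum_rank x) (enum_rank y)) AE.
  rewrite /A mxE !enum_rankK => ->; rewrite mxE; apply: eq_bigr => k _.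
  by rewrite mul_mx_diag mxE adjE Dr conjCK mulrAC mulrC.
rewrite /entropy -/A /mxfun -/P -/D (invmx_unitary uP) {1}AE.
have -> : map_mx (fun z : C => Complex (log2 (Re z)) 0) D = \row_i (log2 (Re (D 0 i)))%:C.
  by apply/rowP => i; rewrite !mxE.
rewrite -/(rdiag _) !mulmxA -[_ *m P *m P^t*]mulmxA PP mulmx1.
rewrite mxtrace_mulC !mulmxA PP mul1mx; congr (- _).
rewrite /mxtrace Re_sum; apply: eq_bigr => k _.
by rewrite mulmx_rdiagE !mxE eqxx mulr1n -Dr -rmorphM.
Qed.

(** In the two eigenbases [G] becomes a matrix [H] that intertwines the spectra, and the eigenvalues
    are the row and column sums of its squared moduli. The weights [r i] and [s j] discard zero
    eigenvalues, whose multiplicities may differ. *)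
Lemma sdec_dual k l n p (G : 'M[C]_(n, p)) (r : 'I_k -> R) U (s : 'I_l -> R) V (f : R -> R) :
  sdec (G *m G^t*) r U -> sdec (G^t* *m G) s V ->
  \sum_i r i * f (r i) = \sum_j s j * f (s j).
Proof.
move=> [UU UU' rE] [VV VV' sE]; set H := U *m G *m V^t*.
have HH : H *m H^t* = rdiag r.
  rewrite /H !adjM trmxCK !mulmxA -[_ *m V^t* *m V]mulmxA VV' mulmx1.
  by rewrite -[U *m G *m G^t*]mulmxA rE !mulmxA UU mul1mx -mulmxA UU mulmx1.
have HH' : H^t* *m H = rdiag s.
  rewrite /H !adjM trmxCK !mulmxA -[_ *m U^t* *m U]mulmxA UU' mulmx1.
  by rewrite -[V *m G^t* *m G]mulmxA sE !mulmxA VV mul1mx -mulmxA VV mulmx1.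
have HE i j : (r i)%:C * H i j = H i j * (s j)%:C.
  rewrite -mul_rdiagE -mulmx_rdiagE -HH -HH'. by rewrite (mulmxA H).
have rsum i : r i = \sum_j abs2 (H i j).
  have := congr1 (fun M : 'M_k => Re (M i i)) HH.
  rewrite mxE [rdiag r i i]mxE eqxx mulr1n mxE /= => <-.
  by rewrite Re_sum; apply: eq_bigr => j _; rewrite adjE mulrC abs2E.
have ssum j : s j = \sum_i abs2 (H i j).
  have := congr1 (fun M : 'M_l => Re (M j j)) HH'.
  rewrite mxE [rdiag s j j]mxE eqxx mulr1n mxE /= => <-.
  by rewrite Re_sum; apply: eq_bigr => i _; rewrite adjE abs2E.
transitivity (\sum_i \sum_j abs2 (H i j) * f (r i)).
  by apply: eq_bigr => i _; rewrite -mulr_suml -rsum.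
rewrite exchange_big; apply: eq_bigr => j _ /=; rewrite [X in _ = X * _]ssum mulr_suml.
apply: eq_bigr => i _; have [->|Hn0] := eqVneq (H i j) 0.
  by rewrite abs2E mulr0 /= !mul0r.
by have := HE i j; rewrite mulrC => /(mulfI Hn0) /complexI ->.
Qed.

Lemma entropyE (T K : finType) (X : op R T) (l : K -> R) v :
  eigsys X l v -> entropy X = - \sum_k l k * log2 (l k).
Proof.
move=> h; have [l' [v' [h' ->]]] := herm_eigsys (eigsys_herm h).
congr (- _); have := sdec_unique (fun x => x * log2 x) (eigsys_sdec h') (eigsys_sdec h).
by rewrite (sum_enum_val (fun k => l' k * log2 (l' k))) (sum_enum_val (fun k => l k * log2 (l k))).
Qed.

(** Needed because [G^t* G] is the complex conjugate of the second marginal of a pure state; the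
    spectrum does not change. *)
Lemma eigsys_conj (T K : finType) (X : op R T) (l : K -> R) v :
  eigsys X l v -> eigsys (fun x y => (X x y)^*%R) l (fun k x => (v k x)^*%R).
Proof.
move=> [h1 h2 h3]; split=> [k k'|x y|x y].
- by rewrite -[RHS]conjC_nat -h1 rmorph_sum; apply: eq_bigr => x _; rewrite rmorphM.
- by rewrite -[RHS]conjC_nat -h2 rmorph_sum; apply: eq_bigr => k _; rewrite rmorphM.
- rewrite h3 rmorph_sum; apply: eq_bigr => k _.
  by rewrite /= rmorphM rmorphM /= conjC_real.
Qed.

(* X and Y are the two marginals of the pure state with amplitudes G. *)
Lemma entropy_dual (T U : finType) (G : T -> U -> C) (X : op R T) (Y : op R U) :
  (forall x y, X x y = \sum_u G x u * (G y u)^*) ->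
  (forall u w, Y u w = \sum_x G x u * (G x w)^*) -> entropy X = entropy Y.
Proof.
move=> hX hY.
have hermX : herm_op X.
  move=> x y; rewrite !hX rmorph_sum; apply: eq_bigr => u _ /=.
  by rewrite rmorphM /= conjCK mulrC.
have hermY : herm_op Y.
  move=> x y; rewrite !hY rmorph_sum; apply: eq_bigr => u _ /=.
  by rewrite rmorphM /= conjCK mulrC.
have [l [v [e ->]]] := herm_eigsys hermX.
have [l' [v' [e' ->]]] := herm_eigsys hermY.
have d := eigsys_sdec e; have d' := eigsys_sdec (eigsys_conj e').
have XE : mx X = mx G *m (mx G)^t* by rewrite mx_adj mxM; exact: eq_mx.
have YE : mx (fun x y => (Y x y)^*%R) = (mx G)^t* *m mx G.
  rewrite mx_adj mxM; apply: eq_mx => u w; rewrite hY rmorph_sum.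
  by apply: eq_bigr => x _; rewrite rmorphM /= conjCK.
rewrite XE in d; rewrite YE in d'; have := sdec_dual (@log2 R) d d'.
rewrite (sum_enum_val (fun k => l k * log2 (l k))) => ->.
by rewrite (sum_enum_val (fun k => l' k * log2 (l' k))).
Qed.

Lemma eigsys_val (T K : finType) (X : op R T) (l : K -> R) v :
  eigsys X l v -> forall k, qform X (v k) = (l k)%:C.
Proof.
move=> [h1 h2 h3] k; rewrite /qform.
transitivity (\sum_x \sum_y \sum_j (l j)%:C * ((v k x)^* * v j x) * ((v j y)^* * v k y)).
  apply: eq_bigr => x _; apply: eq_bigr => y _; rewrite h3 mulr_sumr mulr_suml.
  by apply: eq_bigr => j _; ring.
under eq_bigr do rewrite exchange_big.
rewrite exchange_big (bigD1 k) //= [X in _ + X]big1 ?addr0.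
  transitivity (\sum_x (l k)%:C * ((v k x)^* * v k x)).
    by apply: eq_bigr => x _; rewrite -mulr_sumr h1 eqxx mulr1.
  by rewrite -mulr_sumr h1 eqxx mulr1.
move=> j /negPf jk; rewrite big1 // => x _.
by rewrite -mulr_sumr h1 jk mulr0.
Qed.

Lemma eigsys_ge0 (T K : finType) (X : op R T) (l : K -> R) v :
  psd X -> eigsys X l v -> forall k, 0 <= l k.
Proof. by move=> [_ hp] h k; rewrite -lecR -(eigsys_val h); exact: hp. Qed.

Lemma psd_eigsys (T : finType) (X : op R T) : psd X ->
  exists (l : 'I_#|T| -> R) v, eigsys X l v.
Proof. by case=> h _; have [l [v [e _]]] := herm_eigsys h; exists l, v. Qed.

Lemma eigsys_trace (T K : finType) (X : op R T) (l : K -> R) v :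
  eigsys X l v -> \sum_k l k = Re (trace X).
Proof.
move=> h; have := sdec_trace (eigsys_sdec h).
rewrite (sum_enum_val l) => <-; congr Re; rewrite /mxtrace /trace -[RHS]sum_enum_val.
by apply: eq_bigr => i _; rewrite mxE.
Qed.

(** The Kraus operators move to the test vector as their adjoints. *)
Lemma qform_kraus (T T' I : finType) (Kr : I -> T' -> T -> C) (X : op R T) (v : T' -> C) :
  qform (fun x y => \sum_i \sum_a \sum_b Kr i x a * X a b * (Kr i y b)^*) v =
  \sum_i qform X (fun a => \sum_x (Kr i x a)^* * v x).
Proof.
symmetry; rewrite /qform.
transitivity (\sum_x \sum_y \sum_i \sum_a \sum_b
   (v x)^* * (Kr i x a * X a b * (Kr i y b)^*) * v y); last first.
  apply: eq_bigr => x _; apply: eq_bigr => y _; rewrite mulr_sumr mulr_suml.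
  apply: eq_bigr => i _; rewrite mulr_sumr mulr_suml; apply: eq_bigr => a _.
  by rewrite mulr_sumr mulr_suml.
rewrite [RHS]sum3_last; apply: eq_bigr => i _; rewrite [RHS]sum3_last; apply: eq_bigr => a _.
rewrite [RHS]sum3_last; apply: eq_bigr => b _.
rewrite rmorph_sum !mulr_suml; apply: eq_bigr => x _.
rewrite mulr_sumr; apply: eq_bigr => y _.
by rewrite rmorphM /= conjCK; ring.
Qed.

Section DataProcessing.
Variables (T T' I : finType) (Kr : I -> T' -> T -> C).
Variables (rho sigma : op R T) (rho' sigma' : op R T') (kappa : R).
Variables (J L J' L' : finType) (r : J -> R) (e : J -> T -> C) (s : L -> R) (f : L -> T -> C).
Variables (r' : J' -> R) (e' : J' -> T' -> C) (s' : L' -> R) (f' : L' -> T' -> C).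

(** [relD_mono] for operators over finite types. The conditions say in turn that the channel
    preserves the trace, sends 1 to [kappa], sends [rho] to [rho'], and sends [sigma] below
    [sigma']. Measurements have [kappa = 1], a partial trace has the dimension traced out. *)
Theorem data_processing :
  (forall x y, \sum_i \sum_z (Kr i z x)^* * Kr i z y = (x == y)%:R) ->
  0 < kappa ->
  (forall x y, \sum_i \sum_a Kr i x a * (Kr i y a)^* = kappa%:C * (x == y)%:R) ->
  (forall x y, rho' x y = \sum_i \sum_a \sum_b Kr i x a * rho a b * (Kr i y b)^*) ->
  (forall v : T' -> C,
     Re (\sum_i qform sigma (fun a => \sum_x (Kr i x a)^* * v x)) <= Re (qform sigma' v)) ->
  eigsys rho r e -> eigsys sigma s f -> eigsys rho' r' e' -> eigsys sigma' s' f' ->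
  (forall j, 0 <= r j) -> (forall j, 0 <= s j) ->
  (forall j, 0 <= r' j) -> (forall j, 0 <= s' j) ->
  (forall j, s j = 0 -> Re (qform rho (f j)) = 0) ->
  (forall j, s' j = 0 -> Re (qform rho' (f' j)) = 0) ->
  \sum_j r' j * ln (r' j) - \sum_j Re (qform rho' (f' j)) * ln (s' j)
  <= \sum_j r j * ln (r j) - \sum_j Re (qform rho (f j)) * ln (s j).
Proof.
move=> K1 kappa0 K2 rho'E le_s dr ds dr' ds' r0 s0 r'0 s'0 supp supp'.
pose K i := mx (Kr i).
have K1' : \sum_i (K i)^t* *m K i = 1%:M.
  under eq_bigr do rewrite /K mx_adj mxM.
  by rewrite mx_sum mx_scalar; apply: eq_mx => x y; rewrite K1 mul1r.
have kE (X : op R T) : kraus K (mx X) =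
   mx (fun x y => \sum_i \sum_a \sum_b Kr i x a * X a b * (Kr i y b)^*).
  rewrite /kraus; under eq_bigr do rewrite /K mx_adj !mxM.
  rewrite mx_sum; apply: eq_mx => x y; apply: eq_bigr => i _.
  rewrite exchange_big /=; apply: eq_bigr => b _; rewrite mulr_suml.
  by apply: eq_bigr.
have rE : kraus K (mx rho) = mx rho' by rewrite kE; apply: eq_mx => x y; rewrite rho'E.
have d1 := eigsys_sdec dr; have d2 := eigsys_sdec ds.
have d3 := eigsys_sdec dr'; have d4 := eigsys_sdec ds'.
rewrite -rE in d3.
have qE (U Q : finType) (X : op R U) (g : Q -> U -> C) j :
    Re ((mx (fun k x => (g k x)^*%R) *m mx X *m (mx (fun k x => (g k x)^*%R))^t*) j j)
    = Re (qform X (g (enum_val j))).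
  rewrite mx_adj !mxM mxE; congr Re; rewrite /qform exchange_big; apply: eq_bigr => y _ /=.
  by rewrite conjCK mulr_suml; apply: eq_bigr.
have hk : posmx ((kappa%:C)%:M - kraus K 1%:M).
  rewrite (_ : _ - _ = 0); first by move=> p Y; rewrite mulmx0 mul0mx mxtrace0.
  apply/eqP; rewrite subr_eq0; apply/eqP.
  rewrite /kraus; under eq_bigr do rewrite mulmx1 /K mx_adj mxM.
  by rewrite mx_sum mx_scalar; apply: eq_mx => x y; rewrite K2.
have hs : posmx (mx sigma' - kraus K (mx sigma)).
  rewrite kE; set Y := fun x y : T' => _.
  rewrite (_ : _ - _ = mx (fun x y => sigma' x y - Y x y)); last first.
    by apply/matrixP => i j; rewrite !mxE.
  apply: mx_posmx => v; have := le_s v; rewrite -subr_ge0 -ReB.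
  suff -> : qform sigma' v - \sum_i qform sigma (fun a => \sum_x (Kr i x a)^* * v x) =
     qform (fun x y => sigma' x y - Y x y) v by [].
  transitivity (qform sigma' v - qform Y v); last first.
    rewrite /qform -sumrB; apply: eq_bigr => x _; rewrite -sumrB; apply: eq_bigr => y _.
    by rewrite mulrBr mulrBl.
  by rewrite /Y qform_kraus.
have supp2 j : s (enum_val j) = 0 ->
    Re ((mx (fun k x => (f k x)^*%R) *m mx rho *m (mx (fun k x => (f k x)^*%R))^t*) j j) = 0.
  by rewrite qE; exact: supp.
have supp2' j : s' (enum_val j) = 0 ->
    Re ((mx (fun k x => (f' k x)^*%R) *m kraus K (mx rho) *m
         (mx (fun k x => (f' k x)^*%R))^t*) j j) = 0.
  by rewrite rE qE; exact: supp'.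
have := relD_mono K1' (fun i => r0 _) (fun i => r'0 _) d1 d3 kappa0 hk
  (fun i => s0 _) (fun i => s'0 _) d2 d4 hs supp2 supp2'.
rewrite rE; under [X in _ - X <= _]eq_bigr do rewrite qE.
under [X in _ <= _ - X]eq_bigr do rewrite qE.
rewrite (sum_enum_val (fun j => r j * ln (r j))) (sum_enum_val (fun j => r' j * ln (r' j))).
rewrite (sum_enum_val (fun j => Re (qform rho (f j)) * ln (s j))).
by rewrite (sum_enum_val (fun j => Re (qform rho' (f' j)) * ln (s' j))).
Qed.
End DataProcessing.
End Operators.

(** * Projective measurements of the first factor *)

Section Measurements.
Variable R : realType.
Local Notation C := R[i].
Local Notation Re := complex.Re.

Lemma sum_prod (V : zmodType) (S T : finType) (F : S * T -> V) :
  \sum_u F u = \sum_a \sum_b F (a, b).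
Proof. by rewrite pair_bigA; apply: eq_bigr => -[]. Qed.

Lemma sum_delta (T : finType) (F : T -> C) (x : T) :
  \sum_y F y * (x == y)%:R = F x.
Proof.
rewrite (bigD1 x) //= eqxx mulr1 big1 ?addr0 // => y /negPf yx.
by rewrite eq_sym yx mulr0.
Qed.

Lemma sum_deltal (T : finType) (F : T -> C) (x : T) :
  \sum_y (x == y)%:R * F y = F x.
Proof. by rewrite -[RHS](sum_delta F); apply: eq_bigr => y _; rewrite mulrC. Qed.

Definition onb d (psi : 'I_d -> 'I_d -> C) : Prop :=
  forall k l, ip (psi k) (psi l) = (k == l)%:R.

(** A one-sided inverse of a square matrix is two-sided. *)
Lemma onb_complete d (psi : 'I_d -> 'I_d -> C) : onb psi ->
  forall a b, \sum_k psi k a * (psi k b)^* = (a == b)%:R.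
Proof.
move=> h a b; pose P : 'M[C]_d := \matrix_(k, a) (psi k a)^*%R.
have /mulmx1C/matrixP/(_ a b) : P *m P^t* = 1%:M.
  apply/matrixP => k l; rewrite [RHS]mxE -h mxE; apply: eq_bigr => x _.
  by rewrite adjE !mxE conjCK.
rewrite mxE [RHS]mxE => <-; apply: eq_bigr => k _.
by rewrite adjE !mxE conjCK.
Qed.

Definition stdb d (k a : 'I_d) : C := (k == a)%:R.

Lemma onb_stdb d : onb (@stdb d).
Proof.
move=> k l; rewrite /ip; under eq_bigr do rewrite conjC_nat.
by rewrite (sum_deltal (fun a => stdb l a)) /stdb eq_sym.
Qed.

Definition tens d (U : finType) (p : 'I_d -> C) (w : U -> C) (u : 'I_d * U) : C :=
  p u.1 * w u.2.

Section Blocks.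
Variables (d : nat) (U : finType) (psi : 'I_d -> 'I_d -> C).
Hypothesis hpsi : onb psi.

(** The classical-quantum operator with memory block [Y k] attached to the outcome [k]. *)
Definition blockop (Y : 'I_d -> op R U) : op R ('I_d * U)%type :=
  fun u v => \sum_k psi k u.1 * (psi k v.1)^* * Y k u.2 v.2.

(** The unnormalised memory state conditioned on the outcome [k]. *)
Definition blk (X : op R ('I_d * U)%type) (k : 'I_d) : op R U :=
  fun b b' => \sum_c \sum_c' (psi k c)^* * X (c, b) (c', b') * psi k c'.

Lemma measE X u v : meas psi X u v = blockop (blk X) u v.
Proof.
rewrite /meas /blockop /blk; apply: eq_bigr => k _.
rewrite mulr_sumr; apply: eq_bigr => c _; rewrite mulr_sumr.
by apply: eq_bigr => c' _; ring.
Qed.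

(** Each outcome [k] may use its own eigenbasis [w k] of the memory, because different outcomes are
    already orthogonal in the first factor. *)
Lemma eigsys_blockop (J : finType) (Y : 'I_d -> op R U) (l : 'I_d -> J -> R) w :
  (forall k, eigsys (Y k) (l k) (w k)) ->
  eigsys (blockop Y) (fun q : 'I_d * J => l q.1 q.2) (fun q => tens (psi q.1) (w q.1 q.2)).
Proof.
move=> h; split=> [[k j] [k' j']|[a b] [a' b']|[a b] [a' b']]; rewrite sum_prod /tens /=.
- transitivity (ip (psi k) (psi k') * \sum_b (w k j b)^* * w k' j' b).
    rewrite /ip mulr_suml; apply: eq_bigr => a _; rewrite mulr_sumr.
    by apply: eq_bigr => b _; rewrite rmorphM /=; ring.
  rewrite hpsi xpair_eqE; have [<-|_] := eqVneq k k'; last by rewrite mul0r.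
  by case: (h k) => -> _ _; rewrite mul1r.
- transitivity (\sum_k psi k a * (psi k a')^* * (b == b')%:R).
    apply: eq_bigr => k _; case: (h k) => _ <- _; rewrite mulr_sumr.
    by apply: eq_bigr => j _; rewrite rmorphM /=; ring.
  by rewrite -mulr_suml (onb_complete hpsi) xpair_eqE -natrM mulnb.
- apply: eq_bigr => k _; case: (h k) => _ _ ->; rewrite mulr_sumr.
  by apply: eq_bigr => j _; rewrite /= rmorphM /=; ring.
Qed.

Lemma qform_tens X k (w : U -> C) : qform X (tens (psi k) w) = qform (blk X k) w.
Proof.
rewrite /qform sum_prod exchange_big; apply: eq_bigr => b _ /=.
under eq_bigr do rewrite sum_prod exchange_big /=.
rewrite exchange_big; apply: eq_bigr => b' _ /=.
rewrite /blk mulr_sumr mulr_suml; apply: eq_bigr => c _; rewrite mulr_sumr mulr_suml.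
by apply: eq_bigr => c' _; rewrite /tens /= rmorphM /=; ring.
Qed.

Lemma qform_blockop Y (v : 'I_d * U -> C) :
  qform (blockop Y) v = \sum_k qform (Y k) (fun b => \sum_a (psi k a)^* * v (a, b)).
Proof.
transitivity (\sum_u \sum_u' \sum_k
   (v u)^* * (psi k u.1 * (psi k u'.1)^* * Y k u.2 u'.2) * v u').
  by apply: eq_bigr => u _; apply: eq_bigr => u' _; rewrite /blockop mulr_sumr mulr_suml.
rewrite sum3_last; apply: eq_bigr => k _.
rewrite sum_prod exchange_big; apply: eq_bigr => b _ /=.
under eq_bigr do rewrite sum_prod exchange_big /=.
rewrite exchange_big; apply: eq_bigr => b' _ /=.
rewrite rmorph_sum !mulr_suml; apply: eq_bigr => a _; rewrite mulr_sumr.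
by apply: eq_bigr => a' _; rewrite rmorphM /= conjCK; ring.
Qed.

Lemma sum_blk X b b' : \sum_k blk X k b b' = ptr1 X b b'.
Proof.
rewrite /blk /ptr1.
transitivity (\sum_c \sum_c' \sum_k (psi k c' * (psi k c)^*) * X (c, b) (c', b')).
  rewrite [RHS]sum3_last; apply: eq_bigr => k _; apply: eq_bigr => c _.
  by apply: eq_bigr => c' _; ring.
apply: eq_bigr => c _; rewrite -[RHS](sum_deltal (fun c' => X (c, b) (c', b'))).
by apply: eq_bigr => c' _; rewrite -mulr_suml (onb_complete hpsi) eq_sym.
Qed.

Lemma sum_qform_tens X (w : U -> C) : \sum_k qform X (tens (psi k) w) = qform (ptr1 X) w.
Proof.
under eq_bigr do rewrite qform_tens.
rewrite /qform exchange_big; apply: eq_bigr => b _.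
rewrite exchange_big; apply: eq_bigr => b' _.
by rewrite -sum_blk mulr_sumr mulr_suml.
Qed.

End Blocks.

(** Measuring in [phi] after [psi] mixes the blocks with the transition probabilities; this is where
    the overlaps enter the uncertainty relation. *)
Lemma blk_blockop d (U : finType) (psi phi : 'I_d -> 'I_d -> C) (Y : 'I_d -> op R U) k b b' :
  blk phi (blockop psi Y) k b b' =
  \sum_j (abs2 (ip (psi j) (phi k)))%:C * Y j b b'.
Proof.
rewrite /blk /blockop.
transitivity (\sum_c \sum_c' \sum_j
   ((psi j c * (phi k c)^*) * ((psi j c')^* * phi k c') * Y j b b')).
  apply: eq_bigr => c _; apply: eq_bigr => c' _; rewrite mulr_sumr mulr_suml.
  by apply: eq_bigr => j _ /=; ring.
rewrite sum3_last; apply: eq_bigr => j _.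
rewrite -abs2C /ip rmorph_sum !mulr_suml; apply: eq_bigr => c _.
rewrite mulr_sumr mulr_suml.
by apply: eq_bigr => c' _; rewrite rmorphM /= conjCK.
Qed.

Lemma psd_blk d (U : finType) (psi : 'I_d -> 'I_d -> C) (X : op R ('I_d * U)%type) k :
  psd X -> psd (blk psi X k).
Proof.
move=> [hX pX]; split=> [b b'|v]; last by rewrite -/(qform _ v) -qform_tens; exact: pX.
rewrite /blk rmorph_sum exchange_big; apply: eq_bigr => c' _ /=.
rewrite rmorph_sum; apply: eq_bigr => c _ /=.
by rewrite hX !rmorphM /= !conjCK; ring.
Qed.

Lemma eq_qform (T : finType) (X Y : op R T) v :
  (forall x y, X x y = Y x y) -> qform X v = qform Y v.
Proof. by move=> h; apply: eq_bigr => x _; apply: eq_bigr => y _; rewrite h. Qed.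

Lemma eq_eigsys (T K : finType) (X Y : op R T) (l : K -> R) v :
  (forall x y, X x y = Y x y) -> eigsys X l v -> eigsys Y l v.
Proof. by move=> h [h1 h2 h3]; split=> // x y; rewrite -h h3. Qed.

Lemma eq_entropy (T : finType) (X Y : op R T) :
  (forall x y, X x y = Y x y) -> entropy X = entropy Y.
Proof. by move=> h; rewrite /entropy /mx_of; congr (- Re (\tr (_ *m mxfun _ _))); exact: eq_mx. Qed.

Lemma psd_meas d (U : finType) (psi : 'I_d -> 'I_d -> C) (X : op R ('I_d * U)%type) :
  psd X -> psd (meas psi X).
Proof.
move=> pX; split=> [x y|v].
  rewrite !measE /blockop rmorph_sum; apply: eq_bigr => k _ /=.
  by have [-> _] := psd_blk psi k pX; rewrite !rmorphM /= !conjCK [psi _ _ * _]mulrC.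
rewrite -/(qform _ v) (eq_qform _ (measE psi X)) qform_blockop.
by apply: sumr_ge0 => k _; have [_] := psd_blk psi k pX; apply.
Qed.

Lemma psd_ptr1 d (U : finType) (X : op R ('I_d * U)%type) : psd X -> psd (ptr1 X).
Proof.
move=> [hX pX]; split=> [b b'|v].
  by rewrite /ptr1 rmorph_sum; apply: eq_bigr => c _ /=; rewrite hX.
rewrite -/(qform _ v) -(sum_qform_tens (@onb_stdb d)).
by apply: sumr_ge0 => k _; exact: pX.
Qed.

Lemma meas_eigsys d (U : finType) (psi : 'I_d -> 'I_d -> C) (X : op R ('I_d * U)%type) :
  onb psi -> psd X ->
  exists (l : 'I_d -> 'I_#|U| -> R) w,
   [/\ forall k, eigsys (blk psi X k) (l k) (w k), forall k j, 0 <= l k j &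
       eigsys (meas psi X) (fun q : 'I_d * 'I_#|U| => l q.1 q.2)
              (fun q => tens (psi q.1) (w q.1 q.2))].
Proof.
move=> hpsi pX.
have [l] := fin_all_exists (fun k => psd_eigsys (psd_blk psi k pX)).
move=> /fin_all_exists [w h]; exists l, w; split=> // [k j|].
  exact: (eigsys_ge0 (psd_blk psi k pX) (h k)).
apply: (eq_eigsys (fun x y => esym (measE psi X x y))).
exact: eigsys_blockop.
Qed.

(* The eigenbasis phi (x) beta of c (1 (x) X_B), with X_B = \sum_j b_j |beta_j><beta_j|. *)
Lemma cross_term d (U J : finType) (phi : 'I_d -> 'I_d -> C) (X : op R ('I_d * U)%type)
    (b : J -> R) (beta : J -> U -> C) (c : R) :
  onb phi -> psd X -> eigsys (ptr1 X) b beta -> 0 < c ->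
  (forall q : 'I_d * J, c * b q.2 = 0 -> Re (qform X (tens (phi q.1) (beta q.2))) = 0) /\
  \sum_(q : 'I_d * J) Re (qform X (tens (phi q.1) (beta q.2))) * ln (c * b q.2) =
  ln c * Re (trace X) + \sum_j b j * ln (b j).
Proof.
move=> hphi pX hb c0.
have b0 := eigsys_ge0 (psd_ptr1 pX) hb.
have bE j : \sum_k Re (qform X (tens (phi k) (beta j))) = b j.
  by rewrite -Re_sum (sum_qform_tens hphi) (eigsys_val hb).
have q0 k j : 0 <= Re (qform X (tens (phi k) (beta j))).
  by have := Re_le (proj2 pX (tens (phi k) (beta j))).
(* Nonnegative diagonal entries that add up to [b j] vanish together with it; this provides the
   support condition of [data_processing]. *)
have supp k j : b j = 0 -> Re (qform X (tens (phi k) (beta j))) = 0.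
  move=> bj; have := bE j; rewrite bj => h.
  exact: (psumr_eq0P (fun k _ => q0 k j) h).
split=> [[k j] /= /eqP|].
  by rewrite mulf_eq0 (gt_eqF c0) /= => /eqP; exact: supp.
have -> : Re (trace X) = \sum_j b j.
  rewrite (eigsys_trace hb); congr Re; rewrite /trace sum_prod exchange_big.
  by apply: eq_bigr.
rewrite mulr_sumr -big_split sum_prod exchange_big; apply: eq_bigr => j _ /=.
rewrite -mulr_suml bE.
have [->|bj] := eqVneq (b j) 0; first by rewrite !mul0r mulr0 addr0.
have bj0 : 0 < b j by rewrite lt0r bj b0.
by rewrite lnM ?posrE // mulrDr [ln c * _]mulrC.
Qed.

End Measurements.

(** * Uncertainty relations with one and with two memories *)

Section MemoryRelations.
Variable R : realType.
Local Notation C := R[i].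
Local Notation Re := complex.Re.

Lemma ln2_gt0 : 0 < ln 2 :> R.
Proof. by rewrite ln_gt0 // ltr1n. Qed.

Lemma entropy_ln (T K : finType) (X : op R T) (l : K -> R) v :
  eigsys X l v -> \sum_k l k * ln (l k) = - (entropy X * ln 2).
Proof.
move=> h; rewrite (entropyE h) mulNr opprK mulr_suml; apply: eq_bigr => k _.
by rewrite /log2 mulrA divfK // gt_eqF // ln2_gt0.
Qed.

Lemma trace_ptr1 d (U : finType) (X : op R ('I_d * U)%type) : trace (ptr1 X) = trace X.
Proof. by rewrite /trace sum_prod exchange_big. Qed.

Lemma ptr1_meas d (U : finType) (psi : 'I_d -> 'I_d -> C) (X : op R ('I_d * U)%type) b b' :
  onb psi -> ptr1 (meas psi X) b b' = ptr1 X b b'.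
Proof.
move=> h; rewrite -[RHS](sum_blk h) /ptr1.
under eq_bigr do rewrite measE.
rewrite exchange_big; apply: eq_bigr => k _ /=; rewrite -mulr_suml.
have := h k k; rewrite /ip eqxx.
under eq_bigr do rewrite mulrC.
by move=> ->; rewrite mul1r.
Qed.

Lemma eq_trace (T : finType) (X Y : op R T) :
  (forall x y, X x y = Y x y) -> trace X = trace Y.
Proof. by move=> h; apply: eq_bigr => x _; rewrite h. Qed.

Lemma qform_sum (T I : finType) (a : I -> R) (Y : I -> op R T) v :
  qform (fun x y => \sum_i (a i)%:C * Y i x y) v = \sum_i (a i)%:C * qform (Y i) v.
Proof.
transitivity (\sum_x \sum_y \sum_i (a i)%:C * ((v x)^* * Y i x y * v y)).
  apply: eq_bigr => x _; apply: eq_bigr => y _; rewrite mulr_sumr mulr_suml.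
  by apply: eq_bigr => i _; ring.
rewrite sum3_last; apply: eq_bigr => i _; rewrite mulr_sumr.
by apply: eq_bigr => x _; rewrite mulr_sumr.
Qed.

(** Data processing for the measurement in [phi]. The input relative entropy, of [X] against
    [meas psi X], is [entropy (meas psi X) - entropy X] up to the factor [ln 2]; the output one
    yields the remaining terms. The trace appears because [X] need not be normalised. *)
Lemma uncertainty_memory d (U : finType) (psi phi : 'I_d -> 'I_d -> C)
    (X : op R ('I_d * U)%type) (c : R) :
  onb psi -> onb phi -> psd X -> 0 < c ->
  (forall k l, abs2 (ip (psi k) (phi l)) <= c) ->
  - log2 c * Re (trace X) + entropy X + entropy (ptr1 X)
    <= entropy (meas psi X) + entropy (meas phi X).
Proof.
move=> hpsi hphi pX c0 hc.
have [l [w [hl l0 hs]]] := meas_eigsys hpsi pX.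
have [r [e hr]] := psd_eigsys pX; have r0 := eigsys_ge0 pX hr.
have pM := psd_meas phi pX.
have [r' [e' hr']] := psd_eigsys pM; have r'0 := eigsys_ge0 pM hr'.
have pB := psd_ptr1 pX; have [b [beta hb]] := psd_eigsys pB.
have b0 := eigsys_ge0 pB hb.
have hbM : eigsys (ptr1 (meas phi X)) b beta.
  by apply: eq_eigsys hb => x y; rewrite ptr1_meas.
have [supp' crossE] := cross_term hphi pM hbM c0.
have trM : trace (meas phi X) = trace X.
  by rewrite -trace_ptr1 -[RHS]trace_ptr1; apply: eq_trace => x y; rewrite ptr1_meas.
pose Kr k (u v : 'I_d * U) : C := phi k u.1 * (phi k v.1)^* * (u.2 == v.2)%:R.
(* This is [c] times the identity tensored with the memory state, written in the basis [phi]. *)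
pose sg' : op R ('I_d * U)%type := blockop phi (fun _ x y => c%:C * ptr1 X x y).
have hs' : eigsys sg' (fun q : 'I_d * 'I_#|U| => c * b q.2)
                      (fun q => tens (phi q.1) (beta q.2)).
  apply: (eigsys_blockop hphi (l := fun _ j => c * b j) (w := fun _ => beta)) => _.
  case: hb => h1 h2 h3; split=> // x y; rewrite h3 mulr_sumr.
  by apply: eq_bigr => j _; rewrite rmorphM /=; ring.
have KrC k u v : (Kr k u v)^*%R = Kr k v u.
  by rewrite /Kr !rmorphM /= conjCK conjC_nat eq_sym [_^* * _]mulrC.
have KrM k x y : \sum_z Kr k x z * Kr k z y = Kr k x y.
  rewrite sum_prod /Kr /=.
  transitivity (\sum_a phi k x.1 * ((phi k a)^* * phi k a) * (phi k y.1)^* * (x.2 == y.2)%:R).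
    apply: eq_bigr => a _; rewrite -[RHS](sum_deltal (fun z => _ * (z == y.2)%:R)).
    by apply: eq_bigr => z _; ring.
  by rewrite -!mulr_suml -mulr_sumr -/(ip _ _) hphi eqxx mulr1.
have KrS x y : \sum_k Kr k x y = (x == y)%:R.
  by rewrite -mulr_suml (onb_complete hphi) -natrM mulnb.
have measK x y : meas phi X x y = \sum_i \sum_u \sum_v Kr i x u * X u v * (Kr i y v)^*.
  apply: eq_bigr => k _; rewrite [RHS]sum_prod; apply: eq_bigr => a _.
  transitivity (\sum_b (x.2 == b)%:R * \sum_v phi k x.1 * (phi k a)^* *
      X (a, b) v * (Kr k y v)^*); last first.
    apply: eq_bigr => z _; rewrite mulr_sumr; apply: eq_bigr => v _.
    by rewrite /Kr /=; ring.
  rewrite sum_deltal sum_prod; apply: eq_bigr => a' _ /=.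
  rewrite -[LHS](sum_deltal (fun b' => phi k x.1 * (phi k a)^* * X (a, x.2) (a', b') *
     (phi k a' * (phi k y.1)^* )) y.2).
  by apply: eq_bigr => b' _; rewrite KrC /Kr /= [b' == _]eq_sym; ring.
(* After both measurements each block is a combination of the positive blocks of [psi] with
   coefficients at most [c], and those blocks sum to the memory state. *)
have le_s v : Re (\sum_i qform (meas psi X) (fun u => \sum_x (Kr i x u)^* * v x))
            <= Re (qform sg' v).
  rewrite qform_blockop !Re_sum; apply: ler_sum => i _.
  set vi := fun b => \sum_a (phi i a)^* * v (a, b).
  have -> : qform (meas psi X) (fun u => \sum_x (Kr i x u)^* * v x) =
            qform (meas psi X) (tens (phi i) vi).
    have h u : \sum_x (Kr i x u)^* * v x = tens (phi i) vi u.
      rewrite sum_prod exchange_big /tens /vi /=.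
      transitivity (\sum_b (u.2 == b)%:R * \sum_a phi i u.1 * ((phi i a)^* * v (a, b))).
        apply: eq_bigr => z _; rewrite mulr_sumr; apply: eq_bigr => a _.
        by rewrite KrC /Kr /=; ring.
      by rewrite sum_deltal -mulr_sumr.
    by apply: eq_bigr => x _; apply: eq_bigr => y _; rewrite !h.
  rewrite (eq_qform _ (measE psi X)) qform_tens.
  rewrite (eq_qform _ (blk_blockop psi phi (blk psi X) i)) qform_sum Re_sum.
  have -> : Re (qform (fun x y => c%:C * ptr1 X x y) vi) =
     \sum_j c * Re (qform (blk psi X j) vi).
    rewrite -mulr_sumr -Re_sum -ReZ; congr Re; under [in RHS]eq_bigr do rewrite -qform_tens.
    rewrite (sum_qform_tens hpsi) /qform mulr_sumr; apply: eq_bigr => x _.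
    by rewrite mulr_sumr; apply: eq_bigr => y _; ring.
  apply: ler_sum => j _; rewrite ReZ ler_wpM2r //.
  have [_ h] := psd_blk psi j pX; exact: (Re_le (h vi)).
have supp q : l q.1 q.2 = 0 -> Re (qform X (tens (psi q.1) (w q.1 q.2))) = 0.
  by rewrite qform_tens (eigsys_val (hl _)).
have := @data_processing R _ _ _ Kr X (meas psi X) (meas phi X) sg' 1 _ _ _ _ r e
  (fun q : 'I_d * 'I_#|U| => l q.1 q.2) (fun q => tens (psi q.1) (w q.1 q.2)) r' e'
  (fun q : 'I_d * 'I_#|U| => c * b q.2) (fun q => tens (phi q.1) (beta q.2)).
have hK x y : \sum_i \sum_z (Kr i z x)^* * Kr i z y = (x == y)%:R.
  by rewrite -KrS; apply: eq_bigr => i _; rewrite -KrM; apply: eq_bigr => z _; rewrite KrC.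
have hK' x y : \sum_i \sum_a Kr i x a * (Kr i y a)^* = 1%:C * (x == y)%:R.
  by rewrite mul1r -KrS; apply: eq_bigr => i _; rewrite -KrM; apply: eq_bigr => z _; rewrite KrC.
have b0' (q : 'I_d * 'I_#|U|) : 0 <= c * b q.2 by rewrite mulr_ge0 // ltW.
move=> /(_ hK ltr01 hK' measK le_s hr hs hr' hs' r0 (fun q => l0 _ _) r'0 b0' supp supp').
rewrite crossE trM (entropy_ln hr) (entropy_ln hr') (entropy_ln hb).
(* [X] and [meas psi X] have the same diagonal in this eigenbasis, so the cross term is an
   entropy. *)
have -> : \sum_(j : 'I_d * 'I_#|U|) Re (qform X (tens (psi j.1) (w j.1 j.2))) * ln (l j.1 j.2) =
    \sum_(j : 'I_d * 'I_#|U|) l j.1 j.2 * ln (l j.1 j.2).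
  by apply: eq_bigr => q _; rewrite qform_tens (eigsys_val (hl _)).
rewrite (entropy_ln hs) /log2.
move: (entropy X) (entropy (ptr1 X)) (entropy (meas psi X)) (entropy (meas phi X)).
move: (Re (trace X)) => tX SX SB S1 S2 h.
rewrite -(ler_pM2r ln2_gt0) !mulrDl mulrAC mulNr -mulrN.
rewrite (_ : ln c / ln 2 * _ * _ = - (ln c * tX)); last first.
  by field; rewrite gt_eqF // ln2_gt0.
lra.
Qed.

Lemma psd_gram (T U : finType) (G : T -> U -> C) (X : op R T) :
  (forall x y, X x y = \sum_u G x u * (G y u)^*) -> psd X.
Proof.
move=> hX; split=> [x y|v].
  rewrite !hX rmorph_sum; apply: eq_bigr => u _ /=.
  by rewrite rmorphM /= conjCK mulrC.
suff -> : \sum_x \sum_y (v x)^* * X x y * v y =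
    \sum_u (\sum_y (G y u)^* * v y)^* * (\sum_y (G y u)^* * v y).
  by apply: sumr_ge0 => u _; rewrite abs2C ler0c abs2_ge0.
transitivity (\sum_x \sum_y \sum_u (v x)^* * (G x u * (G y u)^*) * v y).
  by apply: eq_bigr => x _; apply: eq_bigr => y _; rewrite hX mulr_sumr mulr_suml.
rewrite sum3_last; apply: eq_bigr => u _; rewrite rmorph_sum mulr_suml.
apply: eq_bigr => x _; rewrite mulr_sumr; apply: eq_bigr => y _.
by rewrite rmorphM /= conjCK; ring.
Qed.

(** The columns of [G] are the eigenvectors scaled by the square roots of their eigenvalues. *)
Lemma psd_purification (T : finType) (X : op R T) : psd X ->
  exists G : T -> 'I_#|T| -> C, forall x y, X x y = \sum_u G x u * (G y u)^*.
Proof.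
move=> pX; have [l [v h]] := psd_eigsys pX; have l0 := eigsys_ge0 pX h.
exists (fun x k => (Num.sqrt (l k))%:C * v k x) => x y; case: h => _ _ ->.
apply: eq_bigr => k _; rewrite rmorphM /= conjC_real -{1}(sqr_sqrtr (l0 k)) rmorphXn /=.
by ring.
Qed.

(** * Strong subadditivity *)

Section StrongSubadditivity.
Variables (d : nat) (G E : finType).
Implicit Type Y : op R ('I_d * (G * E))%type.

Definition ptr3 Y : op R ('I_d * G)%type :=
  fun u v => \sum_e Y (u.1, (u.2, e)) (v.1, (v.2, e)).

(** The Kraus operators of the partial trace over [E]: the bra of [e] tensored with the identity. *)
Definition trK (e : E) (u : 'I_d * G) (v : 'I_d * (G * E)) : C :=
  ((u.1, (u.2, e)) == v)%:R.

Lemma trK_conj e u v : (trK e u v)^*%R = trK e u v.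
Proof. exact: conjC_nat. Qed.

Lemma ptr3_kraus Y x y :
  ptr3 Y x y = \sum_e \sum_a \sum_b trK e x a * Y a b * (trK e y b)^*.
Proof.
apply: eq_bigr => e _; symmetry.
transitivity (\sum_a trK e x a * \sum_b trK e y b * Y a b).
  apply: eq_bigr => a _; rewrite mulr_sumr; apply: eq_bigr => b _.
  by rewrite trK_conj; ring.
by rewrite sum_deltal sum_deltal.
Qed.

Lemma sum_assoc (V : zmodType) (F : 'I_d * (G * E) -> V) :
  \sum_e \sum_(u : 'I_d * G) F (u.1, (u.2, e)) = \sum_v F v.
Proof.
rewrite sum_prod; under [RHS]eq_bigr do rewrite sum_prod.
by rewrite sum3_last; apply: eq_bigr => e _; rewrite sum_prod.
Qed.

Lemma psd_ptr3 Y : psd Y -> psd (ptr3 Y).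
Proof.
move=> [hY pY]; split=> [x y|v].
  by rewrite rmorph_sum; apply: eq_bigr => e _ /=; rewrite hY.
rewrite -/(qform _ v) (eq_qform _ (ptr3_kraus Y)) qform_kraus.
by apply: sumr_ge0 => e _; exact: pY.
Qed.

Lemma ptr1_ptr3 Y x y : ptr1 (ptr3 Y) x y = ptr2 (ptr1 Y) x y.
Proof. by rewrite /ptr1 /ptr3 /ptr2 exchange_big. Qed.

(** Data processing for the partial trace over [E], with the identity on the first factor tensored
    with the marginal of the rest as second argument. The channel sends 1 to [#|E|], which must be
    positive to serve as [kappa]. *)
Lemma strong_subadditivity Y : (0 < #|E|)%N -> psd Y ->
  entropy Y + entropy (ptr1 (ptr3 Y)) <= entropy (ptr3 Y) + entropy (ptr1 Y).
Proof.
move=> E0 pY; have pY' := psd_ptr3 pY.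
have [r [e hr]] := psd_eigsys pY; have r0 := eigsys_ge0 pY hr.
have [r' [e' hr']] := psd_eigsys pY'; have r'0 := eigsys_ge0 pY' hr'.
have pB := psd_ptr1 pY; have [b [beta hb]] := psd_eigsys pB.
have pB' := psd_ptr1 pY'; have [b' [beta' hb']] := psd_eigsys pB'.
have b0 := eigsys_ge0 pB hb; have b'0 := eigsys_ge0 pB' hb'.
have [supp crossE] := cross_term (@onb_stdb R d) pY hb ltr01.
have [supp' crossE'] := cross_term (@onb_stdb R d) pY' hb' ltr01.
(* The factor 1 in the eigenvalues matches [cross_term] at [c = 1]. *)
have eig1 (U J : finType) (Z : op R U) (z : J -> R) zeta : eigsys Z z zeta ->
    eigsys (blockop (@stdb R d) (fun _ => Z)) (fun q : 'I_d * J => 1 * z q.2)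
           (fun q => tens (@stdb R d q.1) (zeta q.2)).
  move=> hz; apply: (eigsys_blockop (@onb_stdb R d) (l := fun _ j => 1 * z j)
    (w := fun _ => zeta)) => _.
  by case: hz => h1 h2 h3; split=> // x y; rewrite h3; under [RHS]eq_bigr do rewrite mul1r.
have hs := eig1 _ _ _ _ _ hb; have hs' := eig1 _ _ _ _ _ hb'.
have K1 x y : \sum_i \sum_z (trK i z x)^* * trK i z y = (x == y)%:R.
  rewrite -(sum_deltal (fun v => (v == y)%:R) x) -sum_assoc.
  by apply: eq_bigr => i _; apply: eq_bigr => z _; rewrite trK_conj /trK [_ == x]eq_sym.
have K2 x y : \sum_i \sum_a trK i x a * (trK i y a)^* = (#|E|%:R : R)%:C * (x == y)%:R.
  transitivity (\sum_(i : E) ((x == y)%:R : C)).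
    apply: eq_bigr => i _; under eq_bigr do rewrite trK_conj.
    rewrite sum_deltal /trK !xpair_eqE eqxx andbT eq_sym [_.2 == _]eq_sym.
    by case: x y => [? ?] [? ?]; rewrite xpair_eqE.
  by rewrite sumr_const -[LHS]mulr_natl rmorph_nat.
have le_s v : Re (\sum_i qform (blockop (@stdb R d) (fun _ => ptr1 Y))
                   (fun a => \sum_x (trK i x a)^* * v x))
            <= Re (qform (blockop (@stdb R d) (fun _ => ptr1 (ptr3 Y))) v).
  rewrite -qform_kraus le_eqVlt; apply/orP; left; apply/eqP; congr Re; apply: eq_qform => x y.
  rewrite -ptr3_kraus /ptr3 /blockop exchange_big; apply: eq_bigr => k _ /=.
  by rewrite -mulr_sumr ptr1_ptr3.
have := data_processing K1 (_ : 0 < #|E|%:R) K2 (ptr3_kraus Y) le_s hr hs hr' hs'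
  r0 _ r'0 _ supp supp'.
rewrite ltr0n => /(_ E0); rewrite crossE crossE' ln1 !mul0r !add0r.
rewrite (entropy_ln hr) (entropy_ln hr') (entropy_ln hb) (entropy_ln hb') => h.
rewrite -(ler_pM2r ln2_gt0) !mulrDl.
have : - (entropy (ptr3 Y) * ln 2) - - (entropy (ptr1 (ptr3 Y)) * ln 2) <=
   - (entropy Y * ln 2) - - (entropy (ptr1 Y) * ln 2).
  by apply: h => q; rewrite mul1r.
by lra.
Qed.

End StrongSubadditivity.

Lemma eq_meas d (U : finType) (psi : 'I_d -> 'I_d -> C) (X Y : op R ('I_d * U)%type) :
  (forall x y, X x y = Y x y) -> forall x y, meas psi X x y = meas psi Y x y.
Proof.
move=> h x y; apply: eq_bigr => k _; apply: eq_bigr => c _; apply: eq_bigr => c' _.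
by rewrite h.
Qed.

Lemma eq_ptr1 (S T : finType) (X Y : op R (S * T)%type) :
  (forall x y, X x y = Y x y) -> forall x y, ptr1 X x y = ptr1 Y x y.
Proof. by move=> h x y; apply: eq_bigr => k _; rewrite h. Qed.

(** * Two memories: duality through a pure state *)

Section Tripartite.
Variables (d : nat) (B G E : finType) (Psi : 'I_d -> B -> G * E -> C).
Variables (psi phi : 'I_d -> 'I_d -> C) (c : R).

Definition margAB : op R ('I_d * B)%type :=
  fun u v => \sum_g Psi u.1 u.2 g * (Psi v.1 v.2 g)^*.
Definition margAGE : op R ('I_d * (G * E))%type :=
  fun u v => \sum_b Psi u.1 b u.2 * (Psi v.1 b v.2)^*.
Definition margAG : op R ('I_d * G)%type :=
  fun u v => \sum_b \sum_e Psi u.1 b (u.2, e) * (Psi v.1 b (v.2, e))^*.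

(** Both are marginals of one pure state, in which the outcome is recorded coherently in two copies
    of the first system. Tracing out one copy removes the cross terms between outcomes. *)
Lemma entropy_dual_meas : onb psi -> entropy (meas psi margAB) = entropy (meas psi margAGE).
Proof.
move=> hpsi.
pose F k b g := \sum_a (psi k a)^* * Psi a b g.
have blkAB k b b' : blk psi margAB k b b' = \sum_g F k b g * (F k b' g)^*.
  rewrite /blk /margAB /=.
  transitivity (\sum_a \sum_a' \sum_g (psi k a)^* * Psi a b g * ((Psi a' b' g)^* * psi k a')).
    apply: eq_bigr => a _; apply: eq_bigr => a' _; rewrite mulr_sumr mulr_suml.
    by apply: eq_bigr => g _; ring.
  rewrite sum3_last; apply: eq_bigr => g _; rewrite mulr_suml; apply: eq_bigr => a _.
  rewrite rmorph_sum mulr_sumr; apply: eq_bigr => a' _.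
  by rewrite rmorphM /= conjCK; ring.
have blkAG k g g' : blk psi margAGE k g g' = \sum_b F k b g * (F k b g')^*.
  rewrite /blk /margAGE /=.
  transitivity (\sum_a \sum_a' \sum_b (psi k a)^* * Psi a b g * ((Psi a' b g')^* * psi k a')).
    apply: eq_bigr => a _; apply: eq_bigr => a' _; rewrite mulr_sumr mulr_suml.
    by apply: eq_bigr => b _; ring.
  rewrite sum3_last; apply: eq_bigr => b _; rewrite mulr_suml; apply: eq_bigr => a _.
  rewrite rmorph_sum mulr_sumr; apply: eq_bigr => a' _.
  by rewrite rmorphM /= conjCK; ring.
(* The amplitudes of that pure state; [F k] is the partial inner product of [psi k] with [Psi]. *)
pose H (u : 'I_d * B) (v : 'I_d * (G * E)) := \sum_k psi k u.1 * psi k v.1 * F k u.2 v.2.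
have step (a a' : 'I_d) (P Q : 'I_d -> C) :
    \sum_z (\sum_k psi k a * psi k z * P k) * (\sum_k psi k a' * psi k z * Q k)^* =
    \sum_k psi k a * (psi k a')^* * (P k * (Q k)^*).
  transitivity (\sum_z \sum_k \sum_j (psi k a * P k * (psi j a' * Q j)^*) *
      ((psi j z)^* * psi k z)).
    apply: eq_bigr => z _; rewrite mulr_suml; apply: eq_bigr => k _.
    rewrite rmorph_sum mulr_sumr; apply: eq_bigr => j _.
    by rewrite !rmorphM /=; ring.
  rewrite exchange_big; apply: eq_bigr => k _; rewrite exchange_big /=.
  transitivity (\sum_j (psi k a * P k * (psi j a' * Q j)^*) * (k == j)%:R).
    by apply: eq_bigr => j _; rewrite -mulr_sumr -/(ip _ _) hpsi eq_sym.
  by rewrite sum_delta rmorphM /=; ring.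
apply: (entropy_dual (G := H)) => [[a b] [a' b']|[a g] [a' g']]; rewrite measE /blockop /H /=.
  rewrite sum_prod exchange_big /=.
  under [RHS]eq_bigr do rewrite step.
  rewrite exchange_big; apply: eq_bigr => k _ /=.
  by rewrite blkAB mulr_sumr.
rewrite sum_prod exchange_big /=.
transitivity (\sum_b \sum_k psi k a * (psi k a')^* * (F k b g * (F k b g')^*)).
  by rewrite exchange_big; apply: eq_bigr => k _ /=; rewrite blkAG mulr_sumr.
apply: eq_bigr => b _; rewrite -step; apply: eq_bigr => z _.
by congr (_ * (_)^*%R); apply: eq_bigr => k _; congr (_ * _); rewrite mulrC.
Qed.

(** Strong subadditivity of the measured state on [A G E], rewritten by the two dualities, is added
    to [uncertainty_memory] on [A B]; the entropies of [margAB] and [meas psi margAB] cancel. *)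
Lemma uncertainty_tripartite :
  onb psi -> onb phi -> 0 < c -> (0 < #|E|)%N ->
  (forall k l, abs2 (ip (psi k) (phi l)) <= c) ->
  - log2 c * Re (trace margAB) + entropy (ptr1 margAG) + entropy (ptr1 margAB)
    <= entropy (meas psi margAG) + entropy (meas phi margAB).
Proof.
move=> hpsi hphi c0 E0 hc.
have pAB : psd margAB by apply: (psd_gram (G := fun u g => Psi u.1 u.2 g)).
have pAGE : psd margAGE by apply: (psd_gram (G := fun u b => Psi u.1 b u.2)).
have := strong_subadditivity E0 (psd_meas psi pAGE).
rewrite -(entropy_dual_meas hpsi).
have e3 x y : ptr3 margAGE x y = margAG x y.
  by rewrite /ptr3 /margAGE /margAG exchange_big.
have m3 x y : ptr3 (meas psi margAGE) x y = meas psi margAG x y.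
  rewrite -(eq_meas psi e3) /meas /ptr3 exchange_big; apply: eq_bigr => k _.
  rewrite exchange_big; apply: eq_bigr => a _; rewrite exchange_big; apply: eq_bigr => a' _ /=.
  by rewrite mulr_sumr mulr_suml.
rewrite (eq_entropy m3) (eq_entropy (eq_ptr1 m3)).
rewrite (eq_entropy (fun x y => ptr1_meas margAG x y hpsi)).
rewrite (eq_entropy (fun x y => ptr1_meas margAGE x y hpsi)).
have <- : entropy margAB = entropy (ptr1 margAGE).
  apply: (entropy_dual (G := fun u g => Psi u.1 u.2 g)) => // g g'.
  by rewrite sum_prod.
have := uncertainty_memory hpsi hphi pAB c0 hc.
move: (entropy (ptr1 margAG)) (entropy (ptr1 margAB)) (entropy margAB).
move: (entropy (meas psi margAG)) (entropy (meas phi margAB)) (entropy (meas psi margAB)).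
by move: (log2 c) (Re (trace margAB)) => *; lra.
Qed.

End Tripartite.
End MemoryRelations.

(** * A chain of measurements without memory *)

Section MeasurementChain.
Variable R : realType.
Local Notation C := R[i].
Local Notation Re := complex.Re.

Definition diagop d (psi : 'I_d -> 'I_d -> C) (a : 'I_d -> R) : op R 'I_d :=
  fun x y => \sum_k (a k)%:C * (psi k x * (psi k y)^*).

Lemma eigsys_diagop d (psi : 'I_d -> 'I_d -> C) (a : 'I_d -> R) :
  onb psi -> eigsys (diagop psi a) a psi.
Proof. by move=> h; split => //; exact: onb_complete. Qed.

Lemma qform_diagop d (psi : 'I_d -> 'I_d -> C) (a : 'I_d -> R) v :
  qform (diagop psi a) v = (\sum_k a k * abs2 (ip (psi k) v))%:C.
Proof.
rewrite /diagop (qform_sum a (fun k x y => psi k x * (psi k y)^*)) -sum_real_complex.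
apply: eq_bigr => k _; rewrite rmorphM /= -abs2C; congr (_ * _).
rewrite /qform /ip rmorph_sum mulr_suml; apply: eq_bigr => x _.
by rewrite mulr_sumr; apply: eq_bigr => y _; rewrite rmorphM /= conjCK; ring.
Qed.

Lemma abs2M (x y : C) : abs2 (x * y) = abs2 x * abs2 y.
Proof. by apply/complexI; rewrite rmorphM /= -!abs2C rmorphM /=; ring. Qed.

(** Data processing for the measurement in [phi], comparing [rho] with an operator diagonal in
    [psi]; the last condition is domination of its image, which is diagonal in [phi]. *)
Lemma measured_relent d (rho : op R 'I_d) (psi phi : 'I_d -> 'I_d -> C) (a a' : 'I_d -> R) :
  onb psi -> onb phi -> psd rho ->
  (forall k, 0 <= a k) -> (forall k, 0 <= a' k) ->
  (forall k, a k = 0 -> Re (qform rho (psi k)) = 0) ->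
  (forall l, a' l = 0 -> Re (qform rho (phi l)) = 0) ->
  (forall l, \sum_k a k * abs2 (ip (psi k) (phi l)) <= a' l) ->
  \sum_l Re (qform rho (phi l)) * ln (Re (qform rho (phi l)))
    - \sum_l Re (qform rho (phi l)) * ln (a' l)
  <= - (entropy rho * ln 2) - \sum_k Re (qform rho (psi k)) * ln (a k).
Proof.
move=> hpsi hphi pr a0 a'0 supp supp' le_a.
have [r [e hr]] := psd_eigsys pr; have r0 := eigsys_ge0 pr hr.
pose p l := Re (qform rho (phi l)).
have p0 l : 0 <= p l := Re_le (proj2 pr (phi l)).
pose Kr k (x y : 'I_d) : C := phi k x * (phi k y)^*.
have KrC k u v : (Kr k u v)^*%R = Kr k v u by rewrite /Kr !rmorphM /= conjCK mulrC.
have KrM k x y : \sum_z Kr k x z * Kr k z y = Kr k x y.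
  transitivity (\sum_z phi k x * ((phi k z)^* * phi k z) * (phi k y)^*).
    by apply: eq_bigr => z _; rewrite /Kr; ring.
  by rewrite -mulr_suml -mulr_sumr -/(ip _ _) hphi eqxx mulr1.
have KrS x y : \sum_k Kr k x y = (x == y)%:R := onb_complete hphi x y.
have K1 x y : \sum_i \sum_z (Kr i z x)^* * Kr i z y = (x == y)%:R.
  by rewrite -KrS; apply: eq_bigr => i _; rewrite -KrM; apply: eq_bigr => z _; rewrite KrC.
have K2 x y : \sum_i \sum_z Kr i x z * (Kr i y z)^* = 1%:C * (x == y)%:R.
  by rewrite mul1r -KrS; apply: eq_bigr => i _; rewrite -KrM; apply: eq_bigr => z _; rewrite KrC.
have rE x y : diagop phi p x y = \sum_i \sum_u \sum_v Kr i x u * rho u v * (Kr i y v)^*.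
  apply: eq_bigr => i _; rewrite (ge0_ReE (proj2 pr (phi i))) /qform mulr_suml.
  apply: eq_bigr => u _; rewrite mulr_suml; apply: eq_bigr => v _.
  by rewrite KrC /Kr; ring.
have le_s v : Re (\sum_i qform (diagop psi a) (fun u => \sum_x (Kr i x u)^* * v x)) <=
              Re (qform (diagop phi a') v).
  rewrite qform_diagop Re_sum /=; apply: ler_sum => i _.
  have -> : qform (diagop psi a) (fun u => \sum_x (Kr i x u)^* * v x) =
            qform (diagop psi a) (fun u => ip (phi i) v * phi i u).
    have h u : \sum_x (Kr i x u)^* * v x = ip (phi i) v * phi i u.
      by rewrite /ip mulr_suml; apply: eq_bigr => x _; rewrite KrC /Kr; ring.
    by apply: eq_bigr => x _; apply: eq_bigr => y _; rewrite !h.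
  rewrite qform_diagop /=.
  have -> : \sum_k a k * abs2 (ip (psi k) (fun u => ip (phi i) v * phi i u)) =
     (\sum_k a k * abs2 (ip (psi k) (phi i))) * abs2 (ip (phi i) v).
    rewrite mulr_suml; apply: eq_bigr => k _; rewrite -mulrA -abs2M; congr (_ * abs2 _).
    set z := ip (phi i) v; rewrite /ip mulr_suml; apply: eq_bigr => x _.
    by rewrite mulrCA mulrC.
  by rewrite ler_wpM2r ?abs2_ge0.
have hr' := eigsys_diagop p hphi.
have qE l : qform (diagop phi p) (phi l) = (p l)%:C := eigsys_val hr' l.
have supp2 l : a' l = 0 -> Re (qform (diagop phi p) (phi l)) = 0.
  by rewrite qE; exact: supp'.
have := data_processing K1 ltr01 K2 rE le_s hr (eigsys_diagop a hpsi) hr'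
  (eigsys_diagop a' hphi) r0 a0 p0 a'0 supp supp2.
by rewrite (entropy_ln hr); under [X in _ - X <= _]eq_bigr do rewrite qE.
Qed.

Section Chain.
Variables (d : nat) (rho : op R 'I_d) (psi : nat -> 'I_d -> 'I_d -> C).
Hypotheses (hpsi : forall j, onb (psi j)) (hrho : density rho).

Let p j k := Re (qform rho (psi j k)).

(* In the paper's 1-based numbering, aseq j k is the inner sum of b for the first
   j + 2 measurements, as a function of k = k_{j+2}. *)
Fixpoint aseq (j : nat) (k : 'I_d) : R :=
  if j is j'.+1 then \sum_k' aseq j' k' * abs2 (ip (psi j k') (psi j.+1 k))
  else \big[Num.max/0]_(k1 : 'I_d) abs2 (ip (psi 0 k1) (psi 1 k)).

Lemma overlap_total (f g : 'I_d -> 'I_d -> C) k : onb f -> onb g ->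
  \sum_l abs2 (ip (f l) (g k)) = 1.
Proof.
move=> hf hg; have /(congr1 (@complex.Re R)) := qform_diagop f (fun _ => 1) (g k).
rewrite /=; under [in X in _ = X -> _]eq_bigr do rewrite mul1r.
move=> <-; transitivity (Re (ip (g k) (g k))); last by rewrite hg eqxx.
congr Re; apply: eq_bigr => x _.
transitivity (\sum_y (g k x)^* * ((x == y)%:R * g k y)).
  apply: eq_bigr => y _; rewrite /diagop; under eq_bigr do rewrite mul1r.
  by rewrite (onb_complete hf) mulrA.
by rewrite -mulr_sumr sum_deltal.
Qed.

Lemma bigmax_ge0 (F : 'I_d -> R) : 0 <= \big[Num.max/0]_k F k.
Proof. exact: bigmax_ge_id. Qed.

(** The overlaps with a fixed unit vector sum to 1, so they are not all zero. Positivity makes the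
    support conditions along the chain vacuous. *)
Lemma aseq_gt0 j k : 0 < aseq j k.
Proof.
elim: j k => [|j IH] k /=.
  rewrite lt_neqAle bigmax_ge0 andbT; apply/eqP => h.
  have := overlap_total k (hpsi 0) (hpsi 1); rewrite big1.
    by move/eqP; rewrite eq_sym oner_eq0.
  move=> l _; apply/eqP; rewrite eq_le abs2_ge0 andbT h.
  exact: (le_bigmax _ (fun k1 => abs2 (ip (psi 0 k1) (psi 1 k)))).
rewrite lt_neqAle sumr_ge0 ?andbT => [|l _]; last by rewrite mulr_ge0 ?abs2_ge0 // ltW.
apply/eqP => h; have := overlap_total k (hpsi j.+1) (hpsi j.+2).
have h' l : abs2 (ip (psi j.+1 l) (psi j.+2 k)) = 0.
  have := psumr_eq0P (fun l _ => mulr_ge0 (ltW (IH l)) (abs2_ge0 _)) (esym h) (i := l) isT.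
  by move/eqP; rewrite mulf_eq0 (gt_eqF (IH l)) /= => /eqP.
by rewrite big1 // => /eqP; rewrite eq_sym oner_eq0.
Qed.

Let p_ge0 j k : 0 <= p j k.
Proof. by case: hrho => pr _; exact: (Re_le (proj2 pr (psi j k))). Qed.

Let p_sum j : \sum_k p j k = 1.
Proof.
case: hrho => pr tr; rewrite -Re_sum.
transitivity (Re (trace rho)); last by rewrite tr.
congr Re; rewrite /qform.
transitivity (\sum_x \sum_y \sum_k (psi j k y * (psi j k x)^* * rho x y)).
  rewrite [RHS]sum3_last; apply: eq_bigr => k _; apply: eq_bigr => x _.
  by apply: eq_bigr => y _; ring.
apply: eq_bigr => x _; rewrite -[RHS](sum_deltal (fun y => rho x y)).
by apply: eq_bigr => y _; rewrite -mulr_suml (onb_complete (hpsi j)) eq_sym.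
Qed.

(** Each use of [measured_relent] contributes one copy of the entropy of [rho], and its cross term
    on the input side cancels that of the previous use. *)
Lemma chain_bound N :
  N.+1%:R * (entropy rho * ln 2) - \sum_k p N.+1 k * ln (aseq N k)
  <= - \sum_(j < N.+2) \sum_k p j k * ln (p j k).
Proof.
case: hrho => pr _.
have z i l (P : Prop) : aseq i l = 0 -> P by move/eqP; rewrite gt_eqF // aseq_gt0.
elim: N => [|N IH].
  (* The chain starts from the outcome distribution of the first measurement; an average against it
     is at most the maximum. *)
  have le0 l : \sum_k p 0 k * abs2 (ip (psi 0 k) (psi 1 l)) <= aseq 0 l.
    rewrite -[leRHS]mul1r -(p_sum 0) mulr_suml; apply: ler_sum => k _.
    apply: ler_wpM2l => //.
    exact: (le_bigmax _ (fun k1 => abs2 (ip (psi 0 k1) (psi 1 l)))).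
  have := measured_relent (hpsi 0) (hpsi 1) pr (p_ge0 0) (fun k => ltW (aseq_gt0 0 k))
    (fun k h => h) (fun l => @z _ l _) le0.
  by rewrite !big_ord_recr big_ord0 /= add0r mul1r /p; lra.
(* From here on the recursion for [aseq] makes the domination an equality. *)
have := measured_relent (hpsi N.+1) (hpsi N.+2) pr (fun k => ltW (aseq_gt0 N k))
  (fun k => ltW (aseq_gt0 N.+1 k)) (fun l => @z _ l _) (fun l => @z _ l _) (fun l => lexx _).
rewrite big_ord_recr /= -[N.+2%:R]natr1 mulrDl mul1r opprD; move: IH; rewrite /p; lra.
Qed.

Lemma multi_measurement N (b : R) : 0 < b -> (forall k, aseq N k <= b) ->
  N.+1%:R * (entropy rho * ln 2) - ln b <= - \sum_(j < N.+2) \sum_k p j k * ln (p j k).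
Proof.
move=> b0 hb; apply: le_trans (chain_bound N); rewrite lerD2l lerN2.
rewrite -[leRHS]mul1r -(p_sum N.+1) mulr_suml; apply: ler_sum => k _.
by rewrite ler_wpM2l // ler_ln ?posrE // aseq_gt0.
Qed.

End Chain.
End MeasurementChain.

(** * The constant [b] as an iterated sum *)

Section PathSum.
Variable R : realType.
Local Notation C := R[i].
Variables (N d : nat) (hm : (1 < N.+2)%N) (psi : 'I_N.+2 -> 'I_d -> 'I_d -> C).

Let i1 : 'I_N.+2 := Ordinal hm.
Let ov (i : 'I_N.+2) (kappa : {ffun 'I_N.+2 -> 'I_d}) : R :=
  abs2 (ip (psi (prv i) (kappa (prv i))) (psi i (kappa i))).
Let top k : R := \big[Num.max/0]_(k1 : 'I_d) abs2 (ip (psi (prv i1) k1) (psi i1 k)).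
Let pinned j k (kappa : {ffun 'I_N.+2 -> 'I_d}) :=
  [forall i : 'I_N.+2, ((i == 0%N :> nat) || (j <= i)%N) ==> (kappa i == k)].

(** The sum inside [bconst], truncated at position [j]. The coordinates above [j] stay in [kappa]
    but are pinned, so all levels share one index type. *)
Definition path_sum j k : R :=
  \sum_(kappa | pinned j k kappa)
     top (kappa i1) * \prod_(i : 'I_N.+2 | (2 <= i)%N && (i <= j)%N) ov i kappa.

Lemma path_sum_base k : path_sum 1 k = top k.
Proof.
(* At level 1 every coordinate is pinned, so only the constant path remains. *)
rewrite /path_sum (big_pred1 [ffun => k]) => [|kappa].
  rewrite ffunE big_pred0 ?mulr1 // => i; apply/negP => /andP[h1 h2].
  by have := leq_trans h1 h2.
apply/forallP/eqP => [h|-> i]; last by rewrite ffunE eqxx implybT.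
apply/ffunP => i; rewrite ffunE; apply/eqP; apply: (implyP (h i)).
by case: (nat_of_ord i).
Qed.

(* Group the paths by their vertex k' at position j, then re-pin position j and
   everything above it, as well as the dummy position 0, from k to k'. *)
Lemma path_sum_rec j k : (0 < j)%N -> (j < N.+1)%N ->
  path_sum j.+1 k =
  \sum_k' path_sum j k' * abs2 (ip (psi (inord j) k') (psi (inord j.+1) k)).
Proof.
move=> j0 jN.
have jE : (inord j : 'I_N.+2) = j :> nat by rewrite (@inordK N.+1) // ltnW.
have jSE : (inord j.+1 : 'I_N.+2) = j.+1 :> nat by rewrite (@inordK N.+1).
have prvE : prv (inord j.+1) = inord j :> 'I_N.+2.
  by apply: val_inj; rewrite /= jSE jE.
rewrite /path_sum.
rewrite (partition_big (fun kappa : {ffun 'I_N.+2 -> 'I_d} => kappa (inord j)) xpredT) //=.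
apply: eq_bigr => k' _; rewrite mulr_suml.
pose lo (i : 'I_N.+2) := (i == 0%N :> nat) || (j < i)%N.
pose lo' (i : 'I_N.+2) := (i == 0%N :> nat) || (j <= i)%N.
pose h (f : {ffun 'I_N.+2 -> 'I_d}) := [ffun i => if lo i then k else f i].
pose h' (f : {ffun 'I_N.+2 -> 'I_d}) := [ffun i => if lo' i then k' else f i].
have lo_j : lo (inord j) = false by rewrite /lo jE ltnn orbF; case: (j) j0.
have lo_i1 : lo i1 = false by rewrite /lo /= ltnNge j0.
rewrite (reindex_onto h h') => [|f /andP[/forallP hf /eqP fj]]; last first.
  apply/ffunP => i; rewrite /h /h' !ffunE.
  have [loi|nloi] := boolP (lo i); first by apply/esym/eqP/(implyP (hf i)).
  case: ifP => // lo'i; have -> : i = inord j; last by rewrite fj.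
  apply: val_inj; rewrite /= jE; move: nloi lo'i; rewrite /lo /lo'.
  by case: (i == 0%N :> nat) => //=; rewrite -leqNgt => h1 h2; apply/eqP; rewrite eqn_leq h1 h2.
apply: eq_big => [f|f /andP[/andP[_ /eqP hj] _]].
  apply/andP/forallP => [[/andP[_ /eqP hj] /eqP h'h] i|hf].
    by apply/implyP => lo'i; rewrite -h'h /h' ffunE ifT.
  have lo_sub i : lo i -> lo' i.
    by rewrite /lo /lo' => /orP[->//|/ltnW ->]; rewrite orbT.
  split; [apply/andP; split|].
  - by apply/forallP => i; apply/implyP => loi; rewrite /h ffunE ifT.
  - rewrite /h ffunE lo_j; apply: (implyP (hf (inord j))).
    by rewrite jE leqnn orbT.
  apply/eqP/ffunP => i; rewrite /h' /h !ffunE; case: ifP => [lo'i|nlo'].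
    by apply/esym/eqP/(implyP (hf i)).
  by rewrite ifF //; apply: contraFF nlo'; exact: lo_sub.
rewrite {1}/h ffunE lo_i1 -mulrA; congr (_ * _).
rewrite (bigD1 (inord j.+1)) /=; last by rewrite jSE leqnn ltnS j0.
rewrite mulrC; congr (_ * _); last first.
  rewrite /ov prvE hj /h ffunE ifT //.
  by rewrite /lo jSE ltnSn orbT.
apply: eq_big => [i|i /andP[/andP[i2 ij] ine]].
  by rewrite -andbA -val_eqE /= jSE [X in _ && X]andbC -ltn_neqAle ltnS.
have ij' : (i <= j)%N.
  by rewrite -ltnS ltn_neqAle ij andbT; move: ine; rewrite -val_eqE /= jSE.
have loi : lo i = false by rewrite /lo ltnNge ij' orbF; case: (nat_of_ord i) i2.
have lop : lo (prv i) = false.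
  rewrite /lo /= ltnNge (leq_trans (leq_pred _) ij') orbF.
  by case: (nat_of_ord i) i2 => [|[]].
by rewrite /ov /h !ffunE loi lop.
Qed.

Lemma path_sum_aseq j k : (j < N.+1)%N -> path_sum j.+1 k = aseq (fun i => psi (inord i)) j k.
Proof.
elim: j k => [|j IH] k jN.
  rewrite path_sum_base /=; apply: eq_bigr => k1 _.
  by congr (abs2 (ip (psi _ _) (psi _ _))); apply: val_inj; rewrite /= inordK.
rewrite path_sum_rec //=; apply: eq_bigr => k' _.
by rewrite IH // ltnW.
Qed.

Lemma aseq_le_bconst k : aseq (fun i => psi (inord i)) N k <= bconst hm psi.
Proof.
rewrite -path_sum_aseq //.
suff -> : bconst hm psi = \big[Num.max/0]_(km : 'I_d) path_sum N.+1 km.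
  exact: (le_bigmax _ (fun k => path_sum N.+1 k)).
apply: eq_bigr => km _; apply: eq_big => [kappa|kappa _].
  apply: eq_forallb => i; congr (((_ || _)) ==> _).
  by rewrite eqn_leq -ltnS ltn_ord.
congr (_ * _); apply: eq_bigl => i.
by rewrite -[(i <= N.+1)%N]ltnS ltn_ord andbT.
Qed.

End PathSum.

(** * Reduced states of the global system *)

Section Reduction.
Variable R : realType.
Local Notation C := R[i].
Local Notation Re := complex.Re.
Variables (d n : nat) (B : 'I_n -> finType).
Local Notation conf := {dffun forall t : 'I_n, B t}.

Definition upd (f : conf) (t : 'I_n) (b : B t) : conf := [ffun s => dfwith (fun s => f s) b s].

Lemma updE (f : conf) t b : @upd f t b t = b.
Proof. by rewrite /upd ffunE dfwith_in. Qed.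

Lemma upd_neq (f : conf) t b s : t != s -> @upd f t b s = f s.
Proof. by move=> ts; rewrite /upd ffunE dfwith_out. Qed.

Lemma updK (f : conf) t b : f t = b -> @upd f t b = f.
Proof.
move=> <-; apply/ffunP => s; have [<-|ts] := eqVneq t s; first by rewrite updE.
by rewrite upd_neq.
Qed.

Lemma upd_upd (f : conf) t b b' : @upd (@upd f t b) t b' = @upd f t b'.
Proof.
apply/ffunP => s; have [<-|ts] := eqVneq t s; first by rewrite !updE.
by rewrite !upd_neq.
Qed.

Lemma updC (f : conf) t b t' c : t != t' -> @upd (@upd f t b) t' c = @upd (@upd f t' c) t b.
Proof.
move=> tt'; apply/ffunP => s; have [<-|ts] := eqVneq t s.
  by rewrite updE upd_neq 1?eq_sym // updE.
have [<-|t's] := eqVneq t' s; first by rewrite updE upd_neq // updE.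
by rewrite !upd_neq.
Qed.

(** The conditions in [red_AB] determine the second index from the first: it differs only in the
    first factor and in the coordinate [t]. *)
Lemma red_ABE (rho : op R (sys d B)) t u v :
  red_AB rho t u v = \sum_(f : conf | f t == u.2) rho (u.1, f) (v.1, upd f v.2).
Proof.
transitivity (\sum_(x : sys d B | (x.1 == u.1) && (x.2 t == u.2)) rho x (v.1, upd x.2 v.2)).
  rewrite [RHS]big_mkcond; apply: eq_bigr => x _; case: ifP => [/andP[x1 x2]|nx].
    rewrite (big_pred1 (v.1, upd x.2 v.2)) // => -[a f] /=; rewrite x1 x2 /= xpair_eqE.
    congr (_ && _); apply/andP/eqP => [[/eqP fv /forallP h]|->].
      apply/ffunP => s; have [<-|ts] := eqVneq t s; first by rewrite updE fv.
      by rewrite upd_neq //; apply/esym/eqP/(implyP (h s)); rewrite eq_sym.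
    rewrite updE; split=> //; apply/forallP => s; apply/implyP => st.
    by rewrite upd_neq // eq_sym.
  rewrite big_pred0 // => y; move: nx; case: (x.1 == u.1) => //=.
  by case: (x.2 t == u.2).
rewrite (reindex_onto (fun f : conf => (u.1, f) : sys d B) snd) /=; last first.
  by move=> [a f] /= /andP[/eqP ->].
by apply: eq_bigl => f; rewrite !eqxx andbT.
Qed.

Lemma red_AE (rho : op R (sys d B)) a a' :
  red_A rho a a' = \sum_(f : conf) rho (a, f) (a', f).
Proof.
transitivity (\sum_(x : sys d B | x.1 == a) rho x (a', x.2)).
  rewrite [RHS]big_mkcond; apply: eq_bigr => x _; case: ifP => x1.
    rewrite (big_pred1 (a', x.2)) // => -[c f] /=.
    by rewrite xpair_eqE [f == _]eq_sym.
  by rewrite big_pred0.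
rewrite (reindex_onto (fun f : conf => (a, f) : sys d B) snd) /=; last first.
  by move=> [c f] /= /eqP ->.
by apply: eq_bigl => f; rewrite !eqxx.
Qed.

Lemma ptr2_red_AB (rho : op R (sys d B)) t a a' : ptr2 (red_AB rho t) a a' = red_A rho a a'.
Proof.
rewrite red_AE [RHS](partition_big (fun f : conf => f t) xpredT) //=.
apply: eq_bigr => b _; rewrite red_ABE /=; apply: eq_bigr => f /eqP fb.
by rewrite updK.
Qed.

Lemma trace_red_A (rho : op R (sys d B)) : trace (red_A rho) = trace rho.
Proof. by rewrite /trace [RHS]sum_prod; apply: eq_bigr => a _; rewrite red_AE. Qed.

Lemma trace_red_AB (rho : op R (sys d B)) t : trace (red_AB rho t) = trace rho.
Proof.
rewrite -trace_red_A /trace sum_prod; apply: eq_bigr => a _.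
by rewrite -(ptr2_red_AB rho t).
Qed.

(** The new range of summation no longer depends on [b], so it can serve as the environment of a
    purification; the coordinate [t] is parked at its value in [f0]. *)
Lemma sum_upd (V : zmodType) (F : conf -> V) (f0 : conf) t b :
  \sum_(f : conf | f t == b) F f = \sum_(e : conf | e t == f0 t) F (upd e b).
Proof.
rewrite (reindex_onto (fun e : conf => upd e b) (fun f => upd f (f0 t))) /=; last first.
  by move=> f /eqP fb; rewrite upd_upd updK.
apply: eq_bigl => e; rewrite updE eqxx upd_upd /=.
apply/eqP/eqP => [<-|h]; first by rewrite updE.
by rewrite updK.
Qed.

Lemma sum_upd2 (V : zmodType) (F : conf -> V) (f0 : conf) t t' b : t != t' ->
  \sum_(f : conf | f t == b) F f =
  \sum_c \sum_(e : conf | (e t == f0 t) && (e t' == f0 t')) F (@upd (upd e b) t' c).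
Proof.
move=> tt'; rewrite (sum_upd _ f0).
rewrite (partition_big (fun f : conf => f t') xpredT) //=; apply: eq_bigr => c _.
rewrite (reindex_onto (fun e : conf => @upd e t' c) (fun f => upd f (f0 t'))) /=; last first.
  by move=> f /andP[_ /eqP fc]; rewrite upd_upd updK.
apply: eq_big => [e|e _]; last by rewrite updC // eq_sym.
rewrite updE eqxx andbT upd_upd upd_neq 1?eq_sym //; congr (_ && _).
apply/eqP/eqP => [<-|h]; first by rewrite updE.
by rewrite updK.
Qed.

Section State.
Variable rho : op R (sys d B).
Hypothesis prho : psd rho.

Lemma psd_red_A : psd (red_A rho).
Proof.
have [G hG] := psd_purification prho.
apply: (psd_gram (G := fun a (q : conf * 'I_#|{: sys d B}|) => G (a, q.1) q.2)) => a a'.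
by rewrite red_AE sum_prod; apply: eq_bigr => f _; rewrite hG.
Qed.

(** A Gram representation with the remaining memories and the purifying index as environment;
    amplitudes vanish unless the coordinate [t] is parked at [f0 t]. *)
Lemma psd_red_AB (f0 : conf) t : psd (red_AB rho t).
Proof.
have [G hG] := psd_purification prho.
apply: (psd_gram (G := fun u (q : conf * 'I_#|{: sys d B}|) =>
   if q.1 t == f0 t then G (u.1, upd q.1 u.2) q.2 else 0)) => u v.
rewrite red_ABE (sum_upd _ f0) sum_prod big_mkcond; apply: eq_bigr => e _ /=.
case: ifP => _; last by rewrite big1 // => k _; rewrite mul0r.
by rewrite upd_upd hG.
Qed.

(** [uncertainty_tripartite] for a purification of [rho], with memories [B t] and [B t'] and
    everything else in [E]. *)
Lemma uncertainty_red (f0 : conf) t t' (psi phi : 'I_d -> 'I_d -> C) (c : R) :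
  t != t' -> onb psi -> onb phi -> 0 < c -> (0 < d)%N ->
  (forall k l, abs2 (ip (psi k) (phi l)) <= c) ->
  - log2 c * Re (trace rho) + entropy (ptr1 (red_AB rho t')) + entropy (ptr1 (red_AB rho t))
    <= entropy (meas psi (red_AB rho t')) + entropy (meas phi (red_AB rho t)).
Proof.
move=> tt' hpsi hphi c0 d0 hc; have [G hG] := psd_purification prho.
pose E := (conf * 'I_#|{: sys d B}|)%type.
pose Psi a (b : B t) (g : B t' * E) : C :=
  if (g.2.1 t == f0 t) && (g.2.1 t' == f0 t')
  then G (a, @upd (upd g.2.1 b) t' g.1) g.2.2 else 0.
have E0 : (0 < #|{: E}|)%N.
  have i0 : 'I_#|{: sys d B}|.
    by apply: (@enum_rank {: sys d B}); exact: (Ordinal d0, f0).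
  by apply/card_gt0P; exists (f0, i0).
have rAB u v : margAB Psi u v = red_AB rho t u v.
  rewrite /margAB red_ABE (sum_upd2 _ f0 _ tt') sum_prod; apply: eq_bigr => c' _.
  rewrite sum_prod [RHS]big_mkcond; apply: eq_bigr => e _; rewrite /Psi /=.
  case: ifP => _; last by rewrite big1 // => k _; rewrite mul0r.
  have -> : upd (@upd (upd e u.2) t' c') v.2 = @upd (upd e v.2) t' c'.
    by rewrite (updC e _ _ tt') upd_upd -updC.
  by rewrite hG.
have rAG u v : margAG Psi u v = red_AB rho t' u v.
  rewrite /margAG red_ABE (@sum_upd2 _ _ f0 t' t) 1?eq_sym //; apply: eq_bigr => b _.
  rewrite sum_prod [RHS]big_mkcond; apply: eq_bigr => e _; rewrite /Psi /= andbC.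
  case: ifP => _; last by rewrite big1 // => k _; rewrite mul0r.
  have -> : upd (@upd (upd e u.2) t b) v.2 = @upd (upd e b) t' v.2.
    by rewrite -(updC e _ _ tt') upd_upd.
  by rewrite -(updC e _ _ tt') hG.
have := uncertainty_tripartite Psi hpsi hphi c0 E0 hc.
rewrite (eq_trace rAB) trace_red_AB.
rewrite (eq_entropy (eq_ptr1 rAB)) (eq_entropy (eq_ptr1 rAG)).
by rewrite (eq_entropy (eq_meas psi rAG)) (eq_entropy (eq_meas phi rAB)).
Qed.

(** After tracing out the memory the measured state is diagonal in [psi], with the outcome
    probabilities as eigenvalues. *)
Lemma entropy_ptr2_meas t (psi : 'I_d -> 'I_d -> C) : onb psi ->
  entropy (ptr2 (meas psi (red_AB rho t))) * ln 2 =
  - \sum_k Re (qform (red_A rho) (psi k)) * ln (Re (qform (red_A rho) (psi k))).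
Proof.
move=> hpsi; pose p k := Re (qform (red_A rho) (psi k)).
have h : eigsys (ptr2 (meas psi (red_AB rho t))) p psi.
  apply: (eq_eigsys _ (eigsys_diagop p hpsi)) => a a'.
  rewrite /ptr2; under [RHS]eq_bigr do rewrite measE.
  rewrite /blockop exchange_big; apply: eq_bigr => k _ /=; rewrite -mulr_sumr mulrC.
  congr (_ * _); rewrite /p ge0_ReE; last exact: (proj2 psd_red_A).
  rewrite /qform /blk [RHS]exchange_big; apply: eq_bigr => c _.
  rewrite exchange_big; apply: eq_bigr => c' _ /=.
  by rewrite -(ptr2_red_AB rho t) /ptr2 mulr_sumr mulr_suml.
by rewrite (entropy_ln h) opprK.
Qed.

End State.
End Reduction.

(** * Sums over pairs of measurements *)

Section PairSums.
Variable R : realType.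

Lemma log2_prod (I : finType) (P : pred I) (F : I -> R) :
  (forall i, P i -> 0 < F i) ->
  0 < \prod_(i | P i) F i /\ log2 (\prod_(i | P i) F i) = \sum_(i | P i) log2 (F i).
Proof.
move=> h; apply: (big_ind2 (fun x y : R => 0 < x /\ log2 x = y))
  => [|x1 x2 y1 y2 [p1 <-] [p2 <-]|i Pi].
- by rewrite /log2 ln1 mul0r.
- by rewrite mulr_gt0 // /log2 lnM ?posrE // mulrDl.
- by split=> //; exact: h.
Qed.

Lemma sum_pairs_sym m (F : 'I_m -> 'I_m -> R) : (forall i j, F i j = F j i) ->
  2 * \sum_(i : 'I_m) \sum_(j : 'I_m | (i < j)%N) F i j =
  \sum_(i : 'I_m) \sum_(j : 'I_m | j != i) F i j.
Proof.
move=> sF; rewrite mulrDl mul1r.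
rewrite [X in _ + X](exchange_big_dep xpredT) //= -big_split /=; apply: eq_bigr => i _.
rewrite [RHS](bigID (fun j : 'I_m => (i < j)%N)) /=; congr (_ + _).
  by apply: eq_bigl => j; rewrite andbC -val_eqE /= neq_ltn; case: (i < j)%N; rewrite //= orbT.
apply: eq_big => [j|j _]; last exact: sF.
by rewrite -val_eqE /= -leqNgt ltn_neqAle.
Qed.

Lemma sum_pairs_add m (x : 'I_m -> R) :
  \sum_(i : 'I_m) \sum_(j : 'I_m | (i < j)%N) (x i + x j) = (m%:R - 1) * \sum_i x i.
Proof.
apply: (mulfI (x := 2)); first by rewrite pnatr_eq0.
rewrite (sum_pairs_sym (F := fun i j => x i + x j)) => [|i j]; last by rewrite addrC.
transitivity (\sum_(i : 'I_m) \sum_(j : 'I_m) (x i + x j) - \sum_i (x i + x i)).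
  rewrite -sumrB; apply: eq_bigr => i _.
  by rewrite [X in _ = X - _](bigD1 i) //= addrAC subrr add0r.
under eq_bigr do rewrite big_split sumr_const card_ord.
rewrite big_split /= sumr_const card_ord sumrMnl big_split /=.
by set X := \sum_i x i; rewrite -[X *+ m]mulr_natl; ring.
Qed.

(** Over ordered pairs, each index of a block has one partner fewer than the block has elements; the
    symmetric sum counts every pair twice. *)
Lemma sum_pairs_block m n (tau : 'I_m -> 'I_n) (g : 'I_n -> R) :
  \sum_(i : 'I_m) \sum_(j : 'I_m | (i < j)%N) (if tau i == tau j then g (tau i) else 0) =
  \sum_t (#|[set i | tau i == t]|%:R * (#|[set i | tau i == t]|%:R - 1) / 2) * g t.
Proof.
apply: (mulfI (x := 2)); first by rewrite pnatr_eq0.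
rewrite (sum_pairs_sym (F := fun i j => if tau i == tau j then g (tau i) else 0))
  => [|i j]; last first.
  by rewrite [tau j == _]eq_sym; case: eqVneq => // ->.
rewrite (partition_big tau xpredT) //= mulr_sumr; apply: eq_bigr => t _.
set A := [set i | tau i == t].
transitivity (\sum_(i | tau i == t) (#|A|%:R - 1) * g t).
  apply: eq_bigr => i /eqP ti; rewrite -big_mkcondr ti.
  rewrite (eq_bigl (mem (A :\ i))) => [|j]; last by rewrite !inE eq_sym [t == _]eq_sym.
  rewrite sumr_const -[LHS]mulr_natl; congr (_ * _).
  have iA : i \in A by rewrite inE ti.
  by rewrite (cardsD1 i A) iA natrD addrAC subrr add0r.
rewrite sumr_const (_ : #|_| = #|A|); last by apply: eq_card => i; rewrite !inE.
by rewrite -[LHS]mulr_natl; field.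
Qed.

End PairSums.

(** * Bounds on the maximal overlaps *)

Section Overlaps.
Variables (R : realType) (m d : nat) (psi : 'I_m -> 'I_d -> 'I_d -> R[i]).

Lemma le_cij i j k l : abs2 (ip (psi i k) (psi j l)) <= cij psi i j.
Proof.
apply: (le_trans (le_bigmax 0 (fun l => abs2 (ip (psi i k) (psi j l))) l)).
exact: (le_bigmax 0 (fun k => \big[Num.max/0]_(l : 'I_d) abs2 (ip (psi i k) (psi j l)))).
Qed.

Lemma cij_gt0 i j : (0 < d)%N -> (forall i, onb (psi i)) -> 0 < cij psi i j.
Proof.
move=> d0 h; pose k : 'I_d := Ordinal d0.
have := overlap_total k (h i) (h j); rewrite ltNge => h1; apply/negP => c0.
move: h1; rewrite big1; first by move/eqP; rewrite eq_sym oner_eq0.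
move=> l _; apply/eqP; rewrite eq_le abs2_ge0 andbT.
exact: le_trans (le_cij _ _ _ _) c0.
Qed.

End Overlaps.

(** * The two lower bounds combined *)

Theorem theorem2 (R : realType) (m n d : nat)
  (hm : (2 <= m)%N) (hn : (1 <= n)%N) (hnm : (n <= m)%N)
  (B : 'I_n -> finType)
  (rho : op R (sys d B)) (hrho : density rho)
  (M : 'I_m -> op R 'I_d) (hM : forall i, herm_op (M i))
  (psi : 'I_m -> 'I_d -> 'I_d -> R[i])
  (hON : forall i k l, ip (psi i k) (psi i l) = (k == l)%:R)
  (heig : forall i k, exists lam : R[i],
      forall a, \sum_(b : 'I_d) M i a b * psi i k b = lam * psi i k a)
  (S : 'I_n -> {set 'I_m})
  (hSne : forall t, S t != set0)
  (hSdisj : forall t t', t != t' -> [disjoint S t & S t'])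
  (hScov : \bigcup_(t : 'I_n) S t = [set: 'I_m]) :
  let log2 := @log2 R in
  let c := cij psi in
  let P := \prod_(i : 'I_m) \prod_(j : 'I_m | (i < j)%N) c i j in
  let b := bconst hm psi in
  let mt (t : 'I_n) : R := (#|S t|)%:R in
  let w (t : 'I_n) : R := mt t * (mt t - 1) / 2 in
  let m1 : R := m%:R - 1 in
  let S_A := entropy (red_A rho) in
  let S_AB (t : 'I_n) := entropy (red_AB rho t) in
  let S_B (t : 'I_n) := entropy (ptr1 (red_AB rho t)) in
  let S_MB (i : 'I_m) (t : 'I_n) := entropy (meas (psi i) (red_AB rho t)) in
  let S_M (i : 'I_m) (t : 'I_n) := entropy (ptr2 (meas (psi i) (red_AB rho t))) in
  let condMB i t := S_MB i t - S_B t in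
  let condAB t := S_AB t - S_B t in
  let I_AB t := S_A + S_B t - S_AB t in
  let I_MB i t := S_M i t + S_B t - S_MB i t in
  let delta' :=
      m1^-1 * log2 (P / b ^+ (m.-1)) + m1 * S_A
      - \sum_(t : 'I_n) (w t / m1) * S_A
      + \sum_(t : 'I_n) (w t / m1) * I_AB t
      - \sum_(t : 'I_n) \sum_(i in S t) I_MB i t in
  \sum_(t : 'I_n) \sum_(i in S t) condMB i t >=
    - m1^-1 * log2 P + m1^-1 * \sum_(t : 'I_n) w t * condAB t
    + Num.max 0 delta'.
Proof.
case: m hm hnm M hM psi hON heig S hSne hSdisj hScov
  => [//|[//|N]] hm _ M _ psi hON _ S _ hSdisj hScov.
pose log2 := @log2 R; pose c := cij psi.
pose P := \prod_(i : 'I_N.+2) \prod_(j : 'I_N.+2 | (i < j)%N) c i j.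
pose b := bconst hm psi; pose mt t : R := #|S t|%:R.
pose w t : R := mt t * (mt t - 1) / 2; pose m1 : R := N.+2%:R - 1.
pose S_A := entropy (red_A rho); pose S_AB t := entropy (red_AB rho t).
pose S_B t := entropy (ptr1 (red_AB rho t)).
pose S_MB i t := entropy (meas (psi i) (red_AB rho t)).
pose S_M i t := entropy (ptr2 (meas (psi i) (red_AB rho t))).
pose condMB i t := S_MB i t - S_B t; pose condAB t := S_AB t - S_B t.
pose I_AB t := S_A + S_B t - S_AB t; pose I_MB i t := S_M i t + S_B t - S_MB i t.
pose delta' := m1^-1 * log2 (P / b ^+ N.+1) + m1 * S_A
  - \sum_(t : 'I_n) (w t / m1) * S_A + \sum_(t : 'I_n) (w t / m1) * I_AB t
  - \sum_(t : 'I_n) \sum_(i in S t) I_MB i t.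
suff main : - m1^-1 * log2 P + m1^-1 * (\sum_(t : 'I_n) w t * condAB t) + Num.max 0 delta'
    <= \sum_(t : 'I_n) \sum_(i in S t) condMB i t by exact: main.
have [prho trho] := hrho.
have onbpsi i : onb (psi i) := hON i.
have Re1 : complex.Re (trace rho) = 1 by rewrite trho.
(* Unit trace excludes an empty index set; a basis index yields both [0 < d] and the reference
   configuration [x0.2]. *)
have [x0 _] : exists x : sys d B, true.
  apply/existsP; apply: contraT => /existsPn h; move: trho; rewrite /trace big1.
    by move/eqP; rewrite eq_sym oner_eq0.
  by move=> x; have := h x.
have d0 : (0 < d)%N by apply: leq_ltn_trans (leq0n _) (ltn_ord x0.1).
have m1E : m1 = N.+1%:R by rewrite /m1 -natr1 addrK.
have m1_gt0 : 0 < m1 by rewrite m1E ltr0n.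
(* The partition becomes a function [tau] that sends each measurement to its memory. *)
have /fin_all_exists[tau tauS] : forall i, exists t, i \in S t.
  move=> i; have : i \in [set: 'I_N.+2] by rewrite inE.
  by rewrite -hScov => /bigcupP[t _ it]; exists t.
have tauE i t : (i \in S t) = (tau i == t).
  apply/idP/eqP => [it|<-]; last exact: tauS.
  apply/eqP; apply: contraT => /hSdisj/disjointFr/(_ (tauS i)).
  by rewrite it.
have sumE (F : 'I_N.+2 -> 'I_n -> R) :
    \sum_t \sum_(i in S t) F i t = \sum_i F i (tau i).
  rewrite [RHS](partition_big tau xpredT) //; apply: eq_bigr => t _.
  by apply: eq_big => [i|i]; rewrite tauE // => /eqP ->.
have c_gt0 i j : 0 < c i j by exact: cij_gt0.
have [P_gt0 logP] : 0 < P /\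
    log2 P = \sum_(i : 'I_N.+2) \sum_(j : 'I_N.+2 | (i < j)%N) log2 (c i j).
  have h (i : 'I_N.+2) := log2_prod (P := fun j : 'I_N.+2 => (i < j)%N) (fun j _ => c_gt0 i j).
  have [? PE] := log2_prod (P := xpredT) (fun i _ => (h i).1); split=> //.
  by apply: (etrans PE); apply: eq_bigr => i _; rewrite (h i).2.
have b_gt0 : 0 < b.
  apply: lt_le_trans (aseq_le_bconst hm psi (Ordinal d0)).
  by apply: aseq_gt0 => j; exact: onbpsi.
rewrite !sumE.
have pair_bound (i j : 'I_N.+2) :
    - log2 (c i j) + (if tau i == tau j then condAB (tau i) else 0)
    <= condMB i (tau i) + condMB j (tau j).
  rewrite /condMB /condAB; have [tij|tij] := eqVneq (tau i) (tau j).
    have := uncertainty_memory (onbpsi i) (onbpsi j) (psd_red_AB prho x0.2 (tau i))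
      (c_gt0 i j) (fun k l => le_cij psi i j k l).
    rewrite trace_red_AB Re1 mulr1 -tij -/(S_AB _) -/(S_B _) -/(S_MB _ _) -/(S_MB j _) -/log2; lra.
  have := uncertainty_red prho x0.2 (_ : tau j != tau i) (onbpsi i) (onbpsi j) (c_gt0 i j)
      d0 (fun k l => le_cij psi i j k l).
  rewrite eq_sym => /(_ tij).
  rewrite Re1 mulr1 -!/(S_B _) -/(S_MB _ _) -/(S_MB j _) -/log2; lra.
(* Summing [pair_bound] over all pairs counts each measurement [m1] times. *)
have base : - m1^-1 * log2 P + m1^-1 * \sum_t w t * condAB t <= \sum_i condMB i (tau i).
  have scale x y : m1 * (- m1^-1 * x + m1^-1 * y) = - x + y.
    by rewrite mulrDr mulrA mulrN mulVKf ?gt_eqF // divff ?gt_eqF // mulN1r.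
  rewrite -(ler_pM2l m1_gt0) scale -sum_pairs_add logP.
  have -> : \sum_t w t * condAB t = \sum_(i : 'I_N.+2) \sum_(j : 'I_N.+2 | (i < j)%N)
     (if tau i == tau j then condAB (tau i) else 0).
    rewrite sum_pairs_block; apply: eq_bigr => t _; rewrite /w /mt.
    suff -> : [set i | tau i == t] = S t by [].
    by apply/setP => i; rewrite inE tauE.
  rewrite -sumrN -big_split; apply: ler_sum => i _ /=.
  rewrite -sumrN -big_split; apply: ler_sum => j _ /=.
  exact: pair_bound.
have meas_bound : m1 * S_A - log2 b <= \sum_i S_M i (tau i).
  pose psiN (j : nat) := psi (inord j).
  have dA : density (red_A rho) by split; [exact: psd_red_A | rewrite trace_red_A].
  have := @multi_measurement R d (red_A rho) psiN (fun j => onbpsi _) dA N b b_gt0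
     (aseq_le_bconst hm psi) => multi.
  rewrite -(ler_pM2r (ln2_gt0 R)) mulrBl /log2 /Defs.log2 divfK ?gt_eqF ?ln2_gt0 //.
  rewrite m1E -[X in X - _]mulrA; apply: (le_trans multi).
  rewrite mulr_suml -sumrN; apply: ler_sum => j _.
  by rewrite entropy_ptr2_meas // /psiN inord_val.
have log_ratio : log2 (P / b ^+ N.+1) = log2 P - m1 * log2 b.
  rewrite /log2 /Defs.log2 ln_div ?posrE ?exprn_gt0 // lnXn // m1E -mulr_natl; ring.
(* [delta'] is exactly the second bound minus the first, so the maximum with 0 selects the better of
   the two. *)
have deltaE : - m1^-1 * log2 P + m1^-1 * (\sum_t w t * condAB t) + delta' =
   m1 * S_A - log2 b - \sum_i I_MB i (tau i).
  rewrite /delta' sumE log_ratio.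
  have -> : \sum_t w t / m1 * I_AB t =
     \sum_t w t / m1 * S_A - m1^-1 * \sum_t w t * condAB t.
    rewrite mulr_sumr -sumrB; apply: eq_bigr => t _; rewrite /I_AB /condAB; ring.
  have -> : m1^-1 * (log2 P - m1 * log2 b) = m1^-1 * log2 P - log2 b.
    by rewrite mulrBr mulKf ?gt_eqF.
  by ring.
(* What remains is [meas_bound], since [condMB] and [I_MB] add up to [S_M]. *)
rewrite addrC -lerBrDr ge_max subr_ge0 base lerBrDl deltaE /=.
rewrite lerBlDr -big_split /=; apply: (le_trans meas_bound); apply: ler_sum => i _.
by rewrite /condMB /I_MB; lra.
Qed.
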